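(* Let $\Psi$ be a set, let $F$ be a field and let $k\subsetneqq F$ be a subfield algebraically closed in $F$. Let $K\subseteq F_\Psi$ be an $\mathfrak S_\Psi$-invariant subfield. Then $F_\Psi$ is an injective cogenerator of the category $\mathrm{Sm}_K(\mathfrak S_\Psi)$. In particular, (i) every smooth $K$-semilinear representation of $\mathfrak S_\Psi$ can be embedded into a direct product of copies of $F_\Psi$; (ii) every smooth $F_\Psi$-semilinear representation of $\mathfrak S_\Psi$ of finite length is isomorphic to a direct sum of copies of $F_\Psi$.
   Context: For a set $S$, $\bigotimes_{k,i\in S}F$ denotes the restricted tensor product over $k$ of copies of $F$ indexed by $S$ (the colimit over finite $I\subseteq S$ of $\bigotimes_{k,i\in I}F$, i.e. finite linear combinations of tensors with almost all factors equal to $1$), and $F_S$ is its field of fractions ($F_\varnothing=k$). $\mathfrak S_\Psi$ (all permutations of $\Psi$, with pointwise stabilizers of finite subsets as a base of open neighbourhoods of $1$) acts on $F_\Psi$ by permuting tensor factors: $\sigma(\otimes_{i}x_i)=\otimes_i x_{\sigma^{-1}(i)}$. For a field $K$ with $\mathfrak S_\Psi$-action, a $K$-semilinear representation is a left module over the skew group ring $K\langle\mathfrak S_\Psi\rangle$ ($(a[g])(b[h])=ab^g[gh]$); it is smooth if all stabilizers are open; $\mathrm{Sm}_K(\mathfrak S_\Psi)$ is the category of such. An object is a cogenerator if every object embeds into a product of copies of it. *)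

(* Defs.v *)
From HB Require Import structures.
From mathcomp Require Import all_boot all_order all_algebra.
Set Implicit Arguments. Unset Strict Implicit. Unset Printing Implicit Defensive.
Import GRing.Theory.
Local Open Scope ring_scope.

Record perm_of (Psi : Type) := Perm {
  pfun : Psi -> Psi; pinv : Psi -> Psi;
  pfunK : cancel pfun pinv; pinvK : cancel pinv pfun }.

Definition perm_one (Psi : Type) : perm_of Psi :=
  @Perm Psi id id (fun _ => erefl) (fun _ => erefl).

Definition perm_mul (Psi : Type) (s t : perm_of Psi) : perm_of Psi :=
  @Perm Psi (pfun s \o pfun t) (pinv t \o pinv s)
    (can_comp (pfunK s) (pfunK t)) (can_comp (pinvK t) (pinvK s)).

Definition fixes_pointwise (Psi : eqType) (S : seq Psi) (s : perm_of Psi) :=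
  forall i, i \in S -> pfun s i = i.

Definition k_indep (F : fieldType) (k : {pred F}) (V : comNzRingType)
  (emb : F -> V) (vs : seq V) : Prop :=
  forall cs : seq F, size cs = size vs -> (forall c, c \in cs -> c \in k) ->
    \sum_(j < size vs) emb cs`_j * vs`_j = 0 -> forall c, c \in cs -> c = 0.

Fixpoint choices (T : Type) (xs : seq (seq T)) : seq (seq T) :=
  match xs with
  | [::] => [:: [::]]
  | s :: xs' => [seq x :: t | x <- s, t <- choices xs']
  end.

(* a is in the image of the restricted tensor product (k-span of the pure
   tensors with almost all factors equal to 1) *)
Definition in_tensor (Psi : eqType) (F : fieldType) (k : {pred F}) (L : fieldType)
  (kappa : F -> L) (iota : Psi -> {rmorphism F -> L}) (a : L) : Prop :=
  exists s : seq (F * seq (Psi * F)),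
    (forall p, p \in s -> p.1 \in k) /\
    a = \sum_(p <- s) kappa p.1 * \prod_(q <- p.2) iota q.1 q.2.

(* (L, kappa, iota) is (up to unique isomorphism) the field of fractions
   F_Psi of the restricted tensor product (x)_{k, i in Psi} F, where
   kappa : k -> L is the structure map and iota i : F -> L is the
   inclusion of the i-th tensor factor (x |-> x (x) 1 (x) 1 ...). *)
Definition is_frac_restricted_tensor (Psi : eqType) (F : fieldType)
  (k : {pred F}) (L : fieldType) (kappa : F -> L)
  (iota : Psi -> {rmorphism F -> L}) : Prop :=
  kappa 1 = 1 /\
  [/\
      (forall a b, a \in k -> b \in k -> kappa (a + b) = kappa a + kappa b),
      (forall a b, a \in k -> b \in k -> kappa (a * b) = kappa a * kappa b),
      (forall i c, c \in k -> iota i c = kappa c),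
      (* the factors are linearly disjoint over k: the natural map from the
         restricted tensor product to L is injective *)
      (forall (I : seq Psi) (xs : seq (seq F)),
         uniq I -> size xs = size I ->
         (forall s, s \in xs -> k_indep k id s) ->
         k_indep k kappa
           [seq \prod_(q <- zip I t) iota q.1 q.2 | t <- choices xs]) &
      (forall z : L, exists a b, [/\ in_tensor k kappa iota a,
          in_tensor k kappa iota b, b != 0 & z = a / b])].

(* act is the permutation action of S_Psi on F_Psi:
   s (x)_i x_i = (x)_i x_{s^-1 i}, i.e. iota i x |-> iota (s i) x *)
Definition is_perm_action (Psi : eqType) (F : fieldType) (k : {pred F})
  (L : fieldType) (kappa : F -> L) (iota : Psi -> {rmorphism F -> L})
  (act : perm_of Psi -> {rmorphism L -> L}) : Prop :=
  (forall s c, c \in k -> act s (kappa c) = kappa c) /\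
  (forall s i x, act s (iota i x) = iota (pfun s i) x).

(* a left module over the skew group ring K<S_Psi>, K carrying the action
   actK: g.(b m) = b^g (g.m),  (gh).m = g.(h.m),  1.m = m *)
Definition semirep (Psi : Type) (K : fieldType) (actK : perm_of Psi -> K -> K)
  (M : lmodType K) (rho : perm_of Psi -> M -> M) : Prop :=
  [/\ (forall s x y, rho s (x + y) = rho s x + rho s y),
      (forall s (a : K) x, rho s (a *: x) = actK s a *: rho s x),
      (forall x, rho (perm_one Psi) x = x) &
      (forall s t x, rho (perm_mul s t) x = rho s (rho t x))].

(* all stabilisers are open *)
Definition smooth (Psi : eqType) (M : Type) (rho : perm_of Psi -> M -> M) :=
  forall x, exists S : seq Psi,
    forall s, fixes_pointwise S s -> rho s x = x.

Definition smooth_semirep (Psi : eqType) (K : fieldType)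
  (actK : perm_of Psi -> K -> K) (M : lmodType K)
  (rho : perm_of Psi -> M -> M) : Prop :=
  semirep actK rho /\ smooth rho.

Definition rep_morph (Psi : Type) (K : fieldType) (M N : lmodType K)
  (rhoM : perm_of Psi -> M -> M) (rhoN : perm_of Psi -> N -> N) (f : M -> N) :=
  [/\ (forall x y, f (x + y) = f x + f y),
      (forall (a : K) x, f (a *: x) = a *: f x) &
      (forall s x, f (rhoM s x) = rhoN s (f x))].

Definition rep_morph_to (Psi : Type) (K L : fieldType) (phi : K -> L)
  (act : perm_of Psi -> L -> L) (M : lmodType K)
  (rhoM : perm_of Psi -> M -> M) (f : M -> L) :=
  [/\ (forall x y, f (x + y) = f x + f y),
      (forall (a : K) x, f (a *: x) = phi a * f x) &
      (forall s x, f (rhoM s x) = act s (f x))].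

Definition subrep (Psi : Type) (K : fieldType) (M : lmodType K)
  (rho : perm_of Psi -> M -> M) (P : M -> Prop) :=
  [/\ P 0, (forall x y, P x -> P y -> P (x + y)),
      (forall (a : K) x, P x -> P (a *: x)) &
      (forall s x, P x -> P (rho s x))].

Definition finite_length (Psi : Type) (K : fieldType) (M : lmodType K)
  (rho : perm_of Psi -> M -> M) : Prop :=
  exists (n : nat) (C : nat -> M -> Prop),
  [/\ (forall j, subrep rho (C j)),
      (forall x, C 0%N x <-> x = 0),
      (forall x, C n x) &
      (forall j, (j < n)%N ->
        [/\ (forall x, C j x -> C j.+1 x),
            (exists x, C j.+1 x /\ ~ C j x) &
            (forall P, subrep rho P -> (forall x, C j x -> P x) ->
               (forall x, P x -> C j.+1 x) ->
               (forall x, P x -> C j x) \/ (forall x, C j.+1 x -> P x))])].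

(* Main.v *)
(* After tensoring up from [K] to [L = F_Psi], one has to extend (resp. find nonzero)
   equivariant [L]-linear functionals on smooth [L]-semilinear representations [V].

   Averaging.  For [b] in [Psi] let [E] be the subfield of [L] of elements not
   involving [b].  Adjoining the elements fixed by the stabiliser of [b] one at a
   time, one builds an [E]-linear retraction [R : L -> E] commuting with that
   stabiliser: for a transcendental element take the constant coefficient of the
   polynomial part, for an algebraic one the coefficient of [1].  If a functional [f] is
   only equivariant for the stabiliser of [b], then [x |-> g (R (f (g^-1 x)))], with [g]
   moving [b] away from the support of [x], is equivariant for the whole group.

   Extension.  By Galois descent [V] is spanned by vectors [w] depending on a finite
   set [A] of indices and fixed by every permutation preserving [A].  Either the
   translates of [w] are linearly independent modulo the domain of the functional,
   which then extends by any value, or a relation expresses [w] through translates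
   sharing fewer than [#|A|] indices with [A]; these have smaller support relative
   to the stabiliser of the other indices involved, so that one extends by induction
   and then averages over these indices.  Functionals separate vectors by the same induction
   together with the linear independence of the embeddings [g] of the field generated by
   the variables in [A]. *)

From HB Require Import structures.
From mathcomp Require Import all_boot all_order all_algebra.
From mathcomp Require Import boolp classical_sets functions.
Require Import Defs.
Set Implicit Arguments. Unset Strict Implicit. Unset Printing Implicit Defensive.
Import GRing.Theory.
Local Open Scope ring_scope.

(** * Equivariant retractions *)

Lemma Zorn_above (T : Type) (P : set (set T)) (A0 : set T) (t0 : T) :
  P A0 -> A0 t0 ->
  (forall (C : set (set T)) X0, C X0 -> (forall X, C X -> P X) ->
     total_on C subset -> P (\bigcup_(X in C) X)%classic) ->
  exists A, [/\ P A, (A0 `<=` A)%classic &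
    forall B, P B -> (A `<=` B)%classic -> B = A].
Proof.
move=> PA0 A0t Pchain.
pose Q : set (set T) := fun X => X = set0 \/ (P X /\ (A0 `<=` X)%classic).
have [C CQ Ctot|A [QA Amax]] := @Zorn_bigcup T Q.
  have [[X0 [CX0 X0ne]]|Cempty] := pselect (exists X0, C X0 /\ X0 <> set0); last first.
    left; apply/seteqP; split=> // t [X CX Xt]; apply: Cempty.
    by exists X; split=> // X0; rewrite X0 in Xt.
  right; have ne X : C X -> X <> set0 -> P X /\ (A0 `<=` X)%classic.
    by move=> /CQ[].
  pose C' : set (set T) := fun X => C X /\ X <> set0.
  have -> : (\bigcup_(X in C) X = \bigcup_(X in C') X)%classic.
    apply/seteqP; split=> t [X CX Xt]; last by exists X => //; case: CX.
    by exists X => //; split=> // X_0; rewrite X_0 in Xt.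
  split; last by move=> t A0t'; exists X0; [split | have [_] := ne _ CX0 X0ne; exact].
  apply: (Pchain C' X0) => // [X [CX Xne]|X Y [CX _] [CY _]]; last exact: Ctot.
  by have [] := ne _ CX Xne.
have [A_0|[PA A0A]] := QA.
  case: (Amax A0); last by right; split.
  split; first by rewrite A_0 => t [].
  by rewrite A_0 => /(_ _ A0t).
exists A; split=> // B PB AB; apply/seteqP; split=> // t Bt.
apply: contrapT => nAt; apply: (Amax B); last by right; split=> // s /A0A/AB.
by split=> // BA; apply: nAt; exact: BA.
Qed.

Definition subfield_prop (L : fieldType) (A : L -> Prop) :=
  [/\ A 1, forall x y, A x -> A y -> A (x - y),
      forall x y, A x -> A y -> A (x * y) & forall x, A x -> A x^-1].

Section SubfieldProp.

Variables (L : fieldType) (A : L -> Prop).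
Hypothesis sfA : subfield_prop A.

Lemma subfield0 : A 0.
Proof. by have [A1 AB _ _] := sfA; rewrite -(subrr 1); apply: AB. Qed.

Lemma subfieldN x : A x -> A (- x).
Proof. by have [_ AB _ _] := sfA; rewrite -sub0r; apply: AB; apply: subfield0. Qed.

Lemma subfieldD x y : A x -> A y -> A (x + y).
Proof.
by have [_ AB _ _] := sfA => Ax /subfieldN Ay; rewrite -[y]opprK; apply: AB.
Qed.

End SubfieldProp.

Section SimpleExtension.

Variables (M L : fieldType) (emb : {rmorphism M -> L}) (x : L).
Variables (G : Type) (sL : G -> {rmorphism L -> L}) (sM : G -> {rmorphism M -> M}).
Hypothesis sLM : forall g a, emb (sM g a) = sL g (emb a).
Hypothesis sLx : forall g, sL g x = x.

(** Graph of an [M]-linear, equivariant functional whose domain is a subfield containing [x]. The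
    penultimate clause is nondegeneracy: every nonzero [z] has an invariant multiple with nonzero
    value, which later makes nonzero averages possible. *)
Definition step_functional (D : L -> M -> Prop) :=
  [/\ subfield_prop (fun z => exists m, D z m), D 1 1,
      forall a z m z' m', D z m -> D z' m' -> D (emb a * z + z') (a * m + m'),
      forall m, D 0 m -> m = 0 &
  [/\ forall g z m, D z m -> D (sL g z) (sM g m),
      forall z m, D z m -> z != 0 ->
        exists w m', [/\ forall g, sL g w = w, D (z * w) m' & m' != 0] &
      exists m, D x m]].

Let ev (p : {poly M}) : L := (map_poly emb p).[x].

Let evD p q : ev (p + q) = ev p + ev q.
Proof. by rewrite /ev rmorphD hornerD. Qed.

Let evN p : ev (- p) = - ev p.
Proof. by rewrite /ev rmorphN hornerN. Qed.

Let evM p q : ev (p * q) = ev p * ev q.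
Proof. by rewrite /ev rmorphM hornerM. Qed.

Let evZ a p : ev (a *: p) = emb a * ev p.
Proof. by rewrite /ev map_polyZ hornerZ. Qed.

Let evX : ev 'X = x.
Proof. by rewrite /ev map_polyX hornerX. Qed.

Let evXn n : ev 'X^n = x ^+ n.
Proof. by rewrite /ev map_polyXn hornerXn. Qed.

Let ev1 : ev 1 = 1.
Proof. by rewrite /ev rmorph1 hornerC. Qed.

Let ev0 : ev 0 = 0.
Proof. by rewrite /ev rmorph0 horner0. Qed.

Let ev_sigma g p : sL g (ev p) = ev (map_poly (sM g) p).
Proof.
rewrite /ev -horner_map sLx -!map_poly_comp; congr (_.[x]).
by apply: eq_map_poly => a /=; rewrite sLM.
Qed.

(* The functional is the constant coefficient of the polynomial part. *)
Lemma step_transcendental :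
  (forall p, p != 0 -> ev p != 0) -> exists D, step_functional D.
Proof.
move=> tr; pose D z m := exists p q : {poly M},
  [/\ q != 0, z = ev p / ev q & m = (p %/ q)`_0].
have Dpq p q : q != 0 -> D (ev p / ev q) (p %/ q)`_0 by exists p, q.
have ev_inj p q : ev p = ev q -> p = q.
  move=> pq; apply/eqP; rewrite -subr_eq0; apply/negPn/negP => /tr.
  by rewrite evD evN pq subrr eqxx.
have domP z m : D z m -> exists p q, q != 0 /\ z = ev p / ev q.
  by move=> [p [q [q0 -> _]]]; exists p, q.
exists D; split.
- split.
  + exists (1 %/ 1)`_0; exists 1, 1; split=> //; first exact: oner_neq0.
    by rewrite ev1 divr1.
  + move=> y z [m /domP[p [q [q0 ->]]]] [m' /domP[p' [q' [q'0 ->]]]].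
    exists ((p * q' - p' * q) %/ (q * q'))`_0.
    exists (p * q' - p' * q), (q * q'); split=> //; first by rewrite mulf_neq0.
    by rewrite evD evN !evM -mulNr addf_div ?tr // mulNr.
  + move=> y z [m /domP[p [q [q0 ->]]]] [m' /domP[p' [q' [q'0 ->]]]].
    exists ((p * p') %/ (q * q'))`_0; exists (p * p'), (q * q').
    by split=> //; rewrite ?mulf_neq0 // !evM mulf_div.
  + move=> y [m /domP[p [q [q0 ->]]]]; have [->|p0] := eqVneq p 0.
      by exists (0 %/ 1)`_0, 0, 1; rewrite oner_neq0 ev0 !mul0r invr0.
    by exists (q %/ p)`_0, q, p; rewrite invf_div.
- exists 1, 1; rewrite oner_neq0 ev1 divr1 divpp ?oner_neq0 //; split=> //.
  by rewrite coef1.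
- move=> a z m z' m' [p [q [q0 -> ->]]] [p' [q' [q'0 -> ->]]].
  exists ((a *: p) * q' + p' * q), (q * q'); split.
  + by rewrite mulf_neq0.
  + by rewrite evD !evM evZ mulrA addf_div ?tr.
  + rewrite divpD coefD divp_pmul2r // [q * q']mulrC divp_pmul2r //.
    by rewrite divpZl coefZ.
- move=> m [p [q [q0 /esym/eqP]]].
  rewrite mulf_eq0 invr_eq0 (negPf (tr _ q0)) orbF => evp0 ->.
  suff -> : p = 0 by rewrite div0p coef0.
  by apply: ev_inj; rewrite ev0; exact/eqP.
split.
- move=> g z m [p [q [q0 -> ->]]].
  exists (map_poly (sM g) p), (map_poly (sM g) q); split.
  + by rewrite map_poly_eq0.
  + by rewrite fmorph_div !ev_sigma.
  + by rewrite -map_divp coef_map.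
- move=> _ _ [p [q [q0 -> _]]]; rewrite mulf_eq0 negb_or => /andP[p0 _].
  have {}p0 : p != 0 by apply: contraNneq p0 => ->; rewrite ev0.
  (* For equal degrees the quotient is a nonzero constant; multiplying by a power of the invariant
     [x] reduces to this case. *)
  have main (p' q' : {poly M}) : p' != 0 -> q' != 0 -> size p' = size q' ->
      (p' %/ q')`_0 != 0.
    move=> p'0 q'0 spq; have : size (p' %/ q') = 1%N.
      by rewrite size_divp // spq; move: q'0; rewrite -size_poly_gt0;
         case: size => // n _; rewrite /= subSnn.
    move=> s1; have := lead_coef_eq0 (p' %/ q'); rewrite /lead_coef s1 => ->.
    by rewrite -size_poly_gt0 s1.
  have Xn0 n : 'X^n != 0 :> {poly M} by rewrite -size_poly_gt0 size_polyXn.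
  have [le|lt] := leqP (size p) (size q).
    exists (x ^+ (size q - size p)), ((p * 'X^(size q - size p)) %/ q)`_0; split.
    + by move=> g; rewrite rmorphXn /= sLx.
    + exists (p * 'X^(size q - size p)), q; split=> //.
      by rewrite evM evXn mulrAC.
    + by apply: main; rewrite ?mulf_neq0 // size_mulXn // subnK.
  exists (x ^- (size p - size q)), (p %/ (q * 'X^(size p - size q)))`_0; split.
  + by move=> g; rewrite fmorphV rmorphXn /= sLx.
  + exists p, (q * 'X^(size p - size q)); split=> //; first by rewrite mulf_neq0.
    by rewrite evM evXn invfM mulrA.
  + by apply: main; rewrite ?mulf_neq0 // size_mulXn // subnK // ltnW.
- by exists ('X %/ 1)`_0, 'X, 1; rewrite oner_neq0 ev1 evX divr1.
Qed.

(* The functional is the coefficient of [1] in the basis of powers of [x]. *)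
Lemma step_algebraic (p0 : {poly M}) :
  p0 != 0 -> ev p0 = 0 -> exists D, step_functional D.
Proof.
move=> p0N0 evp0.
(* A nonzero polynomial of least size vanishing at [x] serves as minimal polynomial [m]. *)
have exn : exists n, `[< exists p : {poly M}, [/\ size p = n, p != 0 & ev p = 0] >].
  by exists (size p0); apply/asboolP; exists p0.
case: (ex_minnP exn) => n /asboolP[m [sm m0 evm]] nmin.
have evP p : ev p = 0 <-> p %% m = 0.
  split=> [evp|/eqP/divpK pm]; last by rewrite -pm evM evm mulr0.
  apply/eqP/negPn/negP => pm0.
  have : (n <= size (p %% m)%R)%N.
    apply: nmin; apply/asboolP; exists (p %% m); split=> //.
    have := evp; rewrite {1}(Pdiv.Field.divp_eq p m) evD evM evm mulr0 add0r; exact.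
  by rewrite -sm leqNgt ltn_modpN0.
have sm1 : (1 < size m)%N.
  rewrite ltnNge; apply/negP => /size1_polyC mC.
  have c0 : m`_0 != 0 by apply: contraNneq m0 => c0; rewrite mC c0.
  move: evm; rewrite mC /ev map_polyC hornerC => /eqP.
  by rewrite fmorph_eq0 (negPf c0).
have mod1 : (1 %% m)`_0 = 1 by rewrite modp_small ?coef1 // size_polyC oner_neq0.
have inv p : ev p != 0 -> exists q, (ev p)^-1 = ev q.
  move=> evpN0; pose g := gcdp p m.
  have [u eqg] := Bezoutp p m.
  have evg : ev g != 0.
    apply: contraNneq evpN0 => evg.
    by rewrite -(divpK (dvdp_gcdl p m)) evM evg mulr0.
  (* [g] divides [m] but does not vanish at [x], so the cofactor vanishes there and by minimality
     has the size of [m]. Bezout then inverts [ev p]. *)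
  have sg : size g = 1%N.
    have gm := divpK (dvdp_gcdr p m); rewrite -/g in gm.
    have h0 : m %/ g != 0 by apply: contraNneq m0 => h0; rewrite -gm h0 mul0r.
    have g0 : g != 0 by apply: contraNneq m0 => g0; rewrite -gm g0 mulr0.
    have : (n <= size (m %/ g)%R)%N.
      apply: nmin; apply/asboolP; exists (m %/ g); split=> //.
      have/eqP : ev (m %/ g) * ev g = 0 by rewrite -evM gm.
      by rewrite mulf_eq0 (negPf evg) orbF => /eqP.
    rewrite -sm -{1}gm size_mul // => le.
    move: (g0); rewrite -size_poly_gt0; case: (size g) le => // [[//|k]] le _.
    by move: le; rewrite addnS /= -[X in (_ <= X)%N]addn0 leq_add2l.
  have /eqpf_eq[c c0 ec] := eqg; rewrite -/g in ec.
  exists ((c * g`_0)^-1 *: u.1).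
  have -> : ev ((c * g`_0)^-1 *: u.1) = (emb (c * g`_0))^-1 * ev u.1.
    by rewrite evZ fmorphV.
  have g0 : g`_0 != 0.
    rewrite -[X in nth _ _ X]/(1.-1) -sg -/(lead_coef g) lead_coef_eq0.
    by rewrite -size_poly_gt0 sg.
  have e : ev u.1 * ev p = emb (c * g`_0).
    have := congr1 ev ec; rewrite evD !evM evm mulr0 addr0 => ->.
    have gC : g = (g`_0)%:P by apply: size1_polyC; rewrite sg.
    by rewrite evZ gC /ev map_polyC hornerC coefC eqxx rmorphM.
  apply: (mulIf evpN0); rewrite mulVf // -mulrA e mulVf //.
  by rewrite fmorph_eq0 mulf_neq0.
have congP p q : ev p = ev q -> p %% m = q %% m.
  move=> pq; have /evP : ev (p - q) = 0 by rewrite evD evN pq subrr.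
  by rewrite modpD modpN => /eqP; rewrite subr_eq0 => /eqP.
pose D z a := exists p : {poly M}, z = ev p /\ a = (p %% m)`_0.
exists D; split.
- split.
  + by exists (1 %% m)`_0, 1; rewrite ev1.
  + move=> y z [_ [p [-> _]]] [_ [q [-> _]]].
    by exists ((p - q) %% m)`_0, (p - q); rewrite evD evN.
  + move=> y z [_ [p [-> _]]] [_ [q [-> _]]].
    by exists ((p * q) %% m)`_0, (p * q); rewrite evM.
  + move=> y [_ [p [-> _]]]; have [->|/inv[q ->]] := eqVneq (ev p) 0.
      by exists (0 %% m)`_0, 0; rewrite invr0 ev0.
    by exists (q %% m)`_0, q.
- by exists 1; rewrite ev1 mod1.
- move=> a z b z' b' [p [-> ->]] [q [-> ->]].
  by exists (a *: p + q); rewrite evD evZ modpD modpZl coefD coefZ.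
- by move=> b [p [/esym/evP e ->]]; rewrite e coef0.
split.
- move=> g z b [p [-> ->]]; exists (map_poly (sM g) p); split.
    by rewrite ev_sigma.
  have evgm : ev (map_poly (sM g) m) = 0 by rewrite -ev_sigma evm rmorph0.
  have /evP/eqP mgm := evgm.
  (* The difference is a multiple of the conjugate of [m], which vanishes at [x] and is therefore
     divisible by [m]. *)
  have -> : map_poly (sM g) p %% m = map_poly (sM g) (p %% m) %% m.
    apply/eqP; rewrite -subr_eq0 -modpN -modpD -rmorphB /=.
    have -> : p - p %% m = p %/ m * m by rewrite {1}(Pdiv.Field.divp_eq p m) addrK.
    by rewrite rmorphM /=; apply: dvdp_mull.
  by rewrite [map_poly _ (p %% m) %% m]modp_small ?coef_map // size_map_poly ltn_modp.
- move=> _ _ [p [-> _]] evpN0; apply: contrapT => nw.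
  (* If all products with powers of [x] had value 0, so would every multiple of [ev p], among them
     1. *)
  have vanish q : ((p * q) %% m)`_0 = 0.
    rewrite -[q]coefK poly_def mulr_sumr.
    elim/big_ind: _ => [|y z hy hz|i _]; first by rewrite mod0p coef0.
      by rewrite modpD coefD hy hz addr0.
    rewrite -scalerAr modpZl coefZ; apply/eqP; rewrite mulf_eq0; apply/orP; right.
    apply/negPn/negP => h; apply: nw; exists (x ^+ i), ((p * 'X^i) %% m)`_0; split=> //.
      by move=> g; rewrite rmorphXn /= sLx.
    by exists (p * 'X^i); rewrite evM evXn.
  have [q e] := inv _ evpN0.
  have : (p * q) %% m = 1 %% m by apply: congP; rewrite evM -e divff // ev1.
  move/(congr1 (fun r : {poly M} => r`_0)); rewrite vanish mod1.
  by move=> /esym/eqP; rewrite oner_eq0.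
- by exists ('X %% m)`_0, 'X; rewrite evX.
Qed.

Lemma step_exists : exists D, step_functional D.
Proof.
have [[p [p0 evp]]|tr] := pselect (exists p : {poly M}, p != 0 /\ ev p = 0).
  exact: step_algebraic p0 evp.
apply: step_transcendental => p p0; apply/negP => /eqP evp.
by apply: tr; exists p.
Qed.

End SimpleExtension.

Section SubfieldType.

Variables (L : fieldType) (M : divringClosed L).

(** The domain of a partial retraction is a predicate on [L]; as a [fieldType] it can serve as the
    base field [M] of [step_exists]. *)
Definition subfield_of := {z : L | z \in M}.
HB.instance Definition _ := SubChoice.on subfield_of.
HB.instance Definition _ := [SubChoice_isSubIntegralDomain of subfield_of by <:].
HB.instance Definition _ := [SubIntegralDomain_isSubField of subfield_of by <:].

Variables (s : {rmorphism L -> L}) (sM : forall z, z \in M -> s z \in M).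

Definition sub_restrict (a : subfield_of) : subfield_of :=
  exist _ (s (val a)) (sM (valP a)).

Lemma sub_restrict_zmod : zmod_morphism sub_restrict.
Proof. by move=> a b; apply: val_inj; rewrite /= rmorphB. Qed.

Lemma sub_restrict_monoid : monoid_morphism sub_restrict.
Proof.
by split=> [|a b]; apply: val_inj; rewrite /= ?rmorph1 ?rmorphM.
Qed.

HB.instance Definition _ :=
  GRing.isZmodMorphism.Build subfield_of subfield_of sub_restrict sub_restrict_zmod.
HB.instance Definition _ :=
  GRing.isMonoidMorphism.Build subfield_of subfield_of sub_restrict sub_restrict_monoid.

End SubfieldType.

Section Retraction.

Variables (L : fieldType) (G : Type) (s : G -> {rmorphism L -> L}) (E : L -> Prop).
Hypothesis subE : subfield_prop E.
Hypothesis sE : forall g x, E x -> E (s g x).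

Let fixed (w : L) := forall g, s g w = w.

(** Stored as a set of pairs so that Zorn's lemma applies to inclusion of graphs; the clause on
    [H (0, y)] gives single-valuedness. *)
Definition partial_retraction (H : set (L * L)) :=
  [/\ subfield_prop (fun z => exists y, H (z, y)),
      forall e, E e -> H (e, e),
      forall e z y z' y', E e -> H (z, y) -> H (z', y') -> H (e * z + z', e * y + y'),
      forall y, H (0, y) -> y = 0 &
  [/\ forall z y, H (z, y) -> E y,
      forall g z y, H (z, y) -> H (s g z, s g y) &
      forall z y, H (z, y) -> z != 0 ->
        exists w y', [/\ fixed w, H (z * w, y') & y' != 0]]].

Lemma partial_retraction_diag :
  partial_retraction (fun p => E p.1 /\ p.2 = p.1).
Proof.
have [E1 EB EM EV] := subE.
split=> //=.
- split.
  + by exists 1.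
  + by move=> x y [_ [Ex _]] [_ [Ey _]]; exists (x - y); split=> //; apply: EB.
  + by move=> x y [_ [Ex _]] [_ [Ey _]]; exists (x * y); split=> //; apply: EM.
  + by move=> x [_ [Ex _]]; exists x^-1; split=> //; apply: EV.
- move=> e z y z' y' Ee [Ez ->] [Ez' ->]; split=> //.
  by apply: (subfieldD subE) => //; apply: EM.
- by move=> y [].
split.
- by move=> z y /= [Ez ->].
- by move=> g z y /= [Ez ->]; split=> //; apply: sE.
- move=> z y /= [Ez _] z0; exists 1, z; rewrite mulr1; split=> // g.
  by rewrite rmorph1.
Qed.

Lemma partial_retraction_chain (C : set (set (L * L))) X0 :
  C X0 -> (forall X, C X -> partial_retraction X) -> total_on C subset ->
  partial_retraction (\bigcup_(X in C) X)%classic.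
Proof.
move=> CX0 CP Ctot.
have join p q : (\bigcup_(X in C) X)%classic p -> (\bigcup_(X in C) X)%classic q ->
    exists X, [/\ C X, X p & X q].
  move=> [X CX Xp] [Y CY Yq]; have [XY|YX] := Ctot _ _ CX CY.
    by exists Y; split=> //; apply: XY.
  by exists X; split=> //; apply: YX.
split.
- split.
  + have [[[y Xy] _ _ _] _ _ _ _] := CP _ CX0.
    by exists y, X0.
  + move=> x x' [y Hx] [y' Hx']; have [X [CX Xx Xx']] := join _ _ Hx Hx'.
    have [[_ B _ _] _ _ _ _] := CP _ CX.
    by have [|z Xz] := B x x' _ (ex_intro _ _ Xx'); [exists y|exists z, X].
  + move=> x x' [y Hx] [y' Hx']; have [X [CX Xx Xx']] := join _ _ Hx Hx'.
    have [[_ _ B _] _ _ _ _] := CP _ CX.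
    by have [|z Xz] := B x x' _ (ex_intro _ _ Xx'); [exists y|exists z, X].
  + move=> x [y [X CX Xx]]; have [[_ _ _ B] _ _ _ _] := CP _ CX.
    by have [|z Xz] := B x; [exists y|exists z, X].
- by move=> e Ee; exists X0 => //; have [_ + _ _ _] := CP _ CX0; apply.
- move=> e z y z' y' Ee Hz Hz'; have [X [CX Xz Xz']] := join _ _ Hz Hz'.
  by exists X => //; have [_ _ + _ _] := CP _ CX; apply.
- by move=> y [X CX Xy]; have [_ _ _ + _] := CP _ CX; apply.
split.
- by move=> z y [X CX Xy]; have [_ _ _ _ [+ _ _]] := CP _ CX; apply; exact: Xy.
- by move=> g z y [X CX Xy]; exists X => //; have [_ _ _ _ [_ + _]] := CP _ CX; apply.
- move=> z y [X CX Xy] z0; have [_ _ _ _ [_ _ nd]] := CP _ CX.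
  by have [w [y' [fw Xw y'0]]] := nd _ _ Xy z0; exists w, y'; split=> //; exists X.
Qed.

(** With [M] the domain of [H], the new map is a step functional from an extension containing [x]
    down to [M], followed by [H]. Nondegeneracy composes, the two invariant multipliers being
    multiplied. *)
Lemma partial_retraction_extend H x : partial_retraction H -> fixed x ->
  exists H', [/\ partial_retraction H', (H `<=` H')%classic & exists y, H' (x, y)].
Proof.
move=> [sub HE Hlin H0 [HvE Hs Hnd]] fx.
pose M := [pred z | `[<exists y, H (z, y)>]].
have Mdiv : divring_closed M.
  have [M1 MB MM MV] := sub; split.
  - exact/asboolP.
  - by move=> a b /asboolP Ma /asboolP Mb; apply/asboolP/MB.
  - by move=> a b /asboolP Ma /asboolP Mb; apply/asboolP/MM => //; apply: MV.
pose M' : divringClosed L := HB.pack_for (divringClosed L) (M : L -> bool)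
  (GRing.isDivringClosed.Build _ _ Mdiv).
have sM g (z : L) : z \in M' -> s g z \in M'.
  by move=> /asboolP[y Hy]; apply/asboolP; exists (s g y); apply: Hs.
pose sM' g : {rmorphism subfield_of M' -> subfield_of M'} := sub_restrict (sM g).
have [D [subD D1 Dlin D0 [Ds Dnd [mx Dx]]]] :=
  @step_exists (subfield_of M') L (val : {rmorphism subfield_of M' -> L})
    x G s sM' (fun g a => erefl) fx.
have Mex (a : subfield_of M') : exists y, H (val a, y).
  by case: a => a aM /=; exact/asboolP.
have H00 : H (0, 0) by apply: HE; apply: subfield0.
have EN1 : E (-1) by apply: (subfieldN subE); case: subE.
have Hval z y y' : H (z, y) -> H (z, y') -> y = y'.
  move=> Hy Hy'; have := Hlin _ _ _ _ _ EN1 Hy Hy'.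
  by rewrite !mulN1r addNr => /H0/eqP; rewrite addrC subr_eq0 => /eqP.
have D00 : D 0 0.
  by have := Dlin (-1) 1 1 1 1 D1 D1; rewrite rmorphN rmorph1 !mulN1r !addNr.
have DM a : D (val a) a.
  by have := Dlin a 1 1 0 0 D1 D00; rewrite !mulr1 !addr0.
have Hin z y : H (z, y) -> exists a : subfield_of M', val a = z.
  by move=> Hz; have zM : z \in M' by [apply/asboolP; exists y]; exists (exist _ z zM).
have Dval z m m' : D z m -> D z m' -> m = m'.
  move=> Dm Dm'; have := Dlin (-1) _ _ _ _ Dm Dm'.
  by rewrite rmorphN rmorph1 !mulN1r addNr => /D0/eqP; rewrite addrC subr_eq0 => /eqP.
pose H' : set (L * L) := fun p => exists m, D p.1 m /\ H (val m, p.2).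
have domH' z : (exists y, H' (z, y)) <-> exists m, D z m.
  split=> [[y [m [Dm _]]]|[m Dm]]; first by exists m.
  by have [y Hy] := Mex m; exists y, m.
have HH' : (H `<=` H')%classic.
  move=> [z y] Hz; have [a az] := Hin _ _ Hz; exists a => /=.
  by rewrite -az; split=> //; rewrite az.
exists H'; split=> //; last by apply/domH'; exists mx.
split.
- have [S1 SB SM SV] := subD; split.
  + exact/domH'.
  + by move=> a b /domH' Ha /domH' Hb; apply/domH'/SB.
  + by move=> a b /domH' Ha /domH' Hb; apply/domH'/SM.
  + by move=> a /domH' Ha; apply/domH'/SV.
- by move=> e Ee; apply/HH'/HE.
- move=> e z y z' y' Ee [m /= [Dz Hm]] [m' /= [Dz' Hm']].
  have [a ae] := Hin _ _ (HE _ Ee).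
  exists (a * m + m') => /=; split; first by rewrite -ae; apply: Dlin.
  by rewrite -/(val m) -/(val m') ae; apply: Hlin.
- by move=> y [m /= [/D0 -> Hm]]; apply: H0.
split.
- by move=> z y [m /= [_ /HvE]].
- move=> g z y [m /= [Dz Hm]]; exists (sM' g m) => /=.
  by split; [apply: Ds|apply: Hs].
- move=> z y [m /= [Dz Hm]] z0; have [w [m' [fw Dw m'0]]] := Dnd _ _ Dz z0.
  have [t Ht] := Mex m'.
  have vm'0 : val m' != 0 by apply: contra_neq m'0 => h; apply: val_inj; rewrite /= -[RHS]h.
  have [w' [y' [fw' Hw' y'0]]] := Hnd _ _ Ht vm'0.
  exists (w * w'), y'; split=> //; first by move=> g; rewrite rmorphM fw fw'.
  have [b be] := Hin _ _ Hw'.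
  (* [w'] lies in [M], so linearity of [D] over [M] turns the value [m'] at [z * w] into [b] at
     [z * (w * w')]. *)
  have ew' : w' = val (b / m') by rewrite /= -/(val b) be mulrAC divff // mul1r.
  exists b => /=; rewrite be; split=> //.
  have := Dlin (b / m') _ _ _ _ Dw D00.
  rewrite !addr0 divfK // => X.
  by have -> : z * (w * w') = val (b / m') * (z * w) by rewrite -ew' [w * w']mulrC mulrCA.
Qed.

(** The domain of a maximal partial retraction is a subfield containing [E] and all invariant
    elements, hence is everything by the generation hypothesis. *)
Lemma equivariant_retraction :
  (forall A, subfield_prop A -> (forall x, E x -> A x) ->
     (forall x, fixed x -> A x) -> forall x, A x) ->
  exists r : L -> L,
  [/\ forall x y, r (x + y) = r x + r y, forall e z, E e -> r (e * z) = e * r z,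
      forall z, E (r z), forall e, E e -> r e = e &
  (forall g z, r (s g z) = s g (r z)) /\
  (forall z, z != 0 -> exists w, fixed w /\ r (z * w) != 0)].
Proof.
move=> gen; have [E1 EB EM EV] := subE.
have [H [HP HE Hmax]] := @Zorn_above _ partial_retraction _ (1, 1)
   partial_retraction_diag (conj E1 erefl) partial_retraction_chain.
have dom x : exists y, H (x, y).
  apply: (gen (fun x => exists y, H (x, y))) x.
  - by case: HP.
  - by move=> x Ex; exists x; apply: HE.
  - move=> x fx; have [H' [H'P HH' [y H'x]]] := partial_retraction_extend HP fx.
    by exists y; rewrite -(Hmax _ H'P HH').
pose r x := projT1 (cid (dom x)).
have Hr x : H (x, r x) by rewrite /r; case: cid.
have [_ HE' Hlin H0 [HvE Hs Hnd]] := HP.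
have EN1 : E (-1) by apply: (subfieldN subE).
have Hval z y : H (z, y) -> r z = y.
  move=> Hy; have := Hlin _ _ _ _ _ EN1 Hy (Hr z).
  by rewrite !mulN1r addNr => /H0/eqP; rewrite addrC subr_eq0 => /eqP.
exists r; split.
- by move=> x y; apply: Hval; have := Hlin 1 _ _ _ _ E1 (Hr x) (Hr y); rewrite !mul1r.
- move=> e z Ee; apply: Hval.
  by have := Hlin _ _ _ _ _ Ee (Hr z) (HE' _ (subfield0 subE)); rewrite !addr0.
- by move=> z; apply: HvE (Hr z).
- by move=> e Ee; apply/Hval/HE'.
split=> [g z|z z0]; first exact/Hval/Hs.
have [w [y [fw Hw y0]]] := Hnd _ _ (Hr z) z0.
by exists w; split=> //; rewrite (Hval _ _ Hw).
Qed.

End Retraction.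

(** * Permutations and averaging *)

Section Permutations.

Variable Psi : eqType.
Implicit Types (s t : perm_of Psi) (X Y D : seq Psi).

Lemma perm_ext s t : pfun s =1 pfun t -> s = t.
Proof.
case: s t => [f g fK gK] [f' g' fK' gK'] /= /funext ff'; rewrite -{}ff' in fK' gK' *.
have gg' : g = g' by apply/funext => x; rewrite -[LHS]fK' gK.
rewrite -{}gg' in fK' gK' *.
by congr Perm; exact: Prop_irrelevance.
Qed.

Definition perm_inv s : perm_of Psi := Perm (pinvK s) (pfunK s).

Lemma perm_mulV s : perm_mul s (perm_inv s) = perm_one Psi.
Proof. by apply: perm_ext => x /=; rewrite pinvK. Qed.

Lemma perm_mulVK s t : perm_mul s (perm_mul (perm_inv s) t) = t.
Proof. by apply: perm_ext => x /=; rewrite pinvK. Qed.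

Lemma perm_mulE s t i : pfun (perm_mul s t) i = pfun s (pfun t i).
Proof. by []. Qed.

Lemma pfun_inj s : injective (pfun s). Proof. exact: can_inj (pfunK s). Qed.

Lemma fixes_inv X s : fixes_pointwise X s -> fixes_pointwise X (perm_inv s).
Proof. by move=> fs i iX /=; rewrite -[in LHS](fs i iX) pfunK. Qed.

Lemma fixes_mul X s t :
  fixes_pointwise X s -> fixes_pointwise X t -> fixes_pointwise X (perm_mul s t).
Proof. by move=> fs ft i iX /=; rewrite ft // fs. Qed.

Lemma fixes_one X : fixes_pointwise X (perm_one Psi).
Proof. by []. Qed.

Lemma fixes_sub X Y s : {subset X <= Y} -> fixes_pointwise Y s -> fixes_pointwise X s.
Proof. by move=> XY fs i /XY/fs. Qed.

Lemma fixes_cat X Y s :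
  fixes_pointwise (X ++ Y) s <-> fixes_pointwise X s /\ fixes_pointwise Y s.
Proof.
split=> [fs|[fX fY] i]; last by rewrite mem_cat => /orP[/fX|/fY].
by split=> i iX; apply: fs; rewrite mem_cat iX ?orbT.
Qed.

Lemma fixes_conj X s g : fixes_pointwise (map (pfun s) X) g ->
  fixes_pointwise X (perm_mul (perm_inv s) (perm_mul g s)).
Proof. by move=> fg i iX /=; rewrite fg ?map_f // pfunK. Qed.

Definition swap_fun (i j x : Psi) := if x == i then j else if x == j then i else x.

Lemma swap_funK i j : cancel (swap_fun i j) (swap_fun i j).
Proof.
move=> x; rewrite /swap_fun; have [->|xi] := eqVneq x i.
  by have [->//|_] := eqVneq j i; rewrite eqxx.
by have [->|xj] := eqVneq x j; rewrite ?eqxx // (negPf xi) (negPf xj).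
Qed.

Definition perm_swap i j : perm_of Psi := Perm (swap_funK i j) (swap_funK i j).

Lemma perm_swapL i j : pfun (perm_swap i j) i = j.
Proof. by rewrite /perm_swap /= /swap_fun eqxx. Qed.

Lemma perm_swapR i j : pfun (perm_swap i j) j = i.
Proof. by rewrite /perm_swap /= /swap_fun eqxx; case: eqP. Qed.

Lemma perm_swapD i j x : x != i -> x != j -> pfun (perm_swap i j) x = x.
Proof. by rewrite /perm_swap /= /swap_fun => /negPf-> /negPf->. Qed.

Lemma perm_swap_conj i j l : i != j -> l != i -> l != j ->
  perm_swap i j = perm_mul (perm_swap j l) (perm_mul (perm_swap i l) (perm_swap j l)).
Proof.
move=> ij li lj; apply: perm_ext => x; rewrite !perm_mulE.
have [->|xi] := eqVneq x i.
  by rewrite perm_swapL [pfun _ i]perm_swapD // 1?eq_sym // perm_swapL perm_swapR.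
have [->|xj] := eqVneq x j.
  by rewrite perm_swapR perm_swapL perm_swapR perm_swapD // eq_sym.
rewrite [LHS]perm_swapD //; have [->|xl] := eqVneq x l.
  by rewrite perm_swapR [pfun _ j]perm_swapD // 1?eq_sym // perm_swapL.
by rewrite !perm_swapD.
Qed.

Lemma fixes_swap X i j : i \notin X -> j \notin X -> fixes_pointwise X (perm_swap i j).
Proof.
move=> iX jX x xX; apply: perm_swapD; first by apply: contraNneq iX => <-.
by apply: contraNneq jX => <-.
Qed.

(** By induction on [X]: a transposition corrects the value at the new point and, by injectivity,
    leaves the earlier values alone. *)
Lemma perm_extension X (f : Psi -> Psi) : {in X &, injective f} ->
  exists s, {in X, pfun s =1 f}.
Proof.
elim: X => [|x X IH] finj; first by exists (perm_one Psi).
have [|s sf] := IH; first by move=> i j iX jX; apply: finj; rewrite inE ?iX ?jX orbT.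
have [xX|xX] := boolP (x \in X).
  by exists s => i; rewrite inE => /predU1P[->|]; apply: sf.
exists (perm_mul (perm_swap (pfun s x) (f x)) s) => i; rewrite inE.
rewrite perm_mulE => /predU1P[->|iX]; first exact: perm_swapL.
have ix : i != x by apply: contraNneq xX => <-.
rewrite -(sf i iX); apply: perm_swapD; first by rewrite (inj_eq (@pfun_inj s)).
rewrite (sf i iX); apply: contra_neq ix; apply: finj; rewrite inE ?eqxx //.
by rewrite iX orbT.
Qed.

Definition infinite_index := forall X, exists i : Psi, i \notin X.

(** Source of generic position: the points of [Y] outside [X] are exchanged one at a time with fresh
    points. *)
Lemma perm_move X Y D : infinite_index ->
  exists s, fixes_pointwise X s /\
    forall i, i \in Y -> i \notin X -> pfun s i \notin D.
Proof.
move=> inf; elim: Y => [|y Y [s [sX sY]]]; first by exists (perm_one Psi).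
have [yX|yX] := boolP (y \in X).
  exists s; split=> // i; rewrite inE => /predU1P[->|]; last exact: sY.
  by rewrite yX.
have [j] := inf (X ++ D ++ map (pfun s) Y); rewrite !mem_cat !negb_or.
move=> /and3P[jX jD jY].
exists (perm_mul (perm_swap (pfun s y) j) s); split=> [i iX|i]; rewrite perm_mulE.
  rewrite (sX i iX); apply: perm_swapD; last by apply: contraNneq jX => <-.
  rewrite -[in X in X != _](sX i iX) (inj_eq (@pfun_inj s)).
  by apply: contraNneq yX => <-.
have [->|iy] := eqVneq i y; first by rewrite (perm_swapL (pfun s y) j).
rewrite inE (negPf iy) => iY iX; rewrite (@perm_swapD (pfun s y) j).
- exact: sY.
- by rewrite (inj_eq (@pfun_inj s)).
- by apply: contraNneq jY => <-; apply: map_f.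
Qed.

End Permutations.

(** Classical equality on permutations gives membership in lists of pairs of a coefficient and a
    permutation. *)
HB.instance Definition _ (Psi : eqType) := gen_eqMixin (perm_of Psi).

(* The support condition defining the field generated by the tensor factors
   other than the [b]-th one. *)
Definition supported_off (Psi : eqType) (L : fieldType)
  (act : perm_of Psi -> {rmorphism L -> L}) (b : Psi) (z : L) :=
  exists Z : seq Psi, b \notin Z /\ forall s, fixes_pointwise Z s -> act s z = z.

(** The properties of [F_Psi] on which the semilinear theory rests; [x i] is to be the [i]-th copy
    of an element outside [k]. [gf_gen] is the generation hypothesis of [equivariant_retraction] for
    the stabiliser of [b]. *)
Record generic_gfield (Psi : eqType) (L : fieldType)
  (act : perm_of Psi -> {rmorphism L -> L}) (x : Psi -> L) : Prop := GenericGField {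
  gf_mul : forall s t z, act (perm_mul s t) z = act s (act t z);
  gf_one : forall z, act (perm_one Psi) z = z;
  gf_smooth : smooth (fun s => act s);
  gf_var : forall s i, act s (x i) = x (pfun s i);
  gf_inj : injective x;
  gf_gen : forall b (A : L -> Prop), subfield_prop A ->
    (forall z, supported_off act b z -> A z) ->
    (forall z, (forall s, fixes_pointwise [:: b] s -> act s z = z) -> A z) ->
    forall z, A z }.

Section GField.

Variables (Psi : eqType) (L : fieldType) (act : perm_of Psi -> {rmorphism L -> L}).
Variable var : Psi -> L.
Hypothesis gf : generic_gfield act var.
Implicit Types (I A Z D X : seq Psi) (s t g h : perm_of Psi) (b : Psi).

Let actM := gf_mul gf.
Let act1 := gf_one gf.

Lemma actKV s z : act s (act (perm_inv s) z) = z.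
Proof. by rewrite -actM perm_mulV act1. Qed.

Lemma actVK s z : act (perm_inv s) (act s z) = z.
Proof.
by rewrite -actM; have -> : perm_mul (perm_inv s) s = perm_one Psi by
  apply: perm_ext => i /=; rewrite pfunK.
Qed.

Lemma supported_off_subfield b : subfield_prop (supported_off act b).
Proof.
have two u v w : (forall s, act s u = u -> act s v = v -> act s w = w) ->
    supported_off act b u -> supported_off act b v -> supported_off act b w.
  move=> uvw [Z [bZ fZ]] [Z' [bZ' fZ']]; exists (Z ++ Z'); split.
    by rewrite mem_cat negb_or bZ.
  by move=> s /fixes_cat[/fZ su /fZ' sv]; apply: uvw.
split.
- by exists [::]; split=> // s _; rewrite rmorph1.
- by move=> u v; apply: two => s su sv; rewrite rmorphB su sv.
- by move=> u v; apply: two => s su sv; rewrite rmorphM /= su sv.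
- by move=> u Hu; apply: (two u u) => // s su _; rewrite fmorphV su.
Qed.

(** Being the identity on elements not involving [b] is left out on purpose: the operators of
    [averaging_nonzero] may lack it. *)
Definition averaging b (R : L -> L) :=
  [/\ forall y z, R (y + z) = R y + R z,
      forall e z, supported_off act b e -> R (e * z) = e * R z,
      forall z, supported_off act b (R z) &
      forall s z, fixes_pointwise [:: b] s -> R (act s z) = act s (R z)].

Lemma averaging0 b R : averaging b R -> R 0 = 0.
Proof. by move=> [RD _ _ _]; apply: (addIr (R 0)); rewrite -RD !add0r. Qed.

Lemma averaging_exists b : exists R, [/\ averaging b R,
  forall e, supported_off act b e -> R e = e &
  forall z, z != 0 -> exists w,
    (forall s, fixes_pointwise [:: b] s -> act s w = w) /\ R (z * w) != 0].
Proof.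
pose G := {s : perm_of Psi | fixes_pointwise [:: b] s}.
have [] := @equivariant_retraction L G (fun g : G => act (sval g)) (supported_off act b).
- exact: supported_off_subfield.
- move=> [g fg] z [Z [bZ fZ]] /=; exists (map (pfun g) Z); split.
    by rewrite -(fg b (mem_head _ _)) mem_map //; apply: pfun_inj.
  by move=> s fs; rewrite -{2}(fZ _ (fixes_conj fs)) -!actM perm_mulVK.
- move=> A sfA AE Afix z; apply: (gf_gen gf (b := b)) => // w fw.
  by apply: Afix => -[g fg]; apply: fw.
move=> r [rD rM rE rid [rs rnd]]; exists r; split=> //.
  by split=> // s z fs; apply: (rs (exist _ s fs)).
move=> z /rnd[w [fw rw]]; exists w; split=> // s fs.
exact: (fw (exist _ s fs)).
Qed.

Lemma averaging_retraction b :
  exists R, averaging b R /\ forall e, supported_off act b e -> R e = e.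
Proof. by have [R [aR idR _]] := averaging_exists b; exists R. Qed.

(** Nondegeneracy provides [w], invariant under the stabiliser of [b], with [R (z * w)] nonzero;
    multiplying by [w] before applying [R] keeps linearity and equivariance. *)
Lemma averaging_nonzero b z : z != 0 -> exists R, averaging b R /\ R z != 0.
Proof.
have [R [[RD RM RE Rs] _ nd]] := averaging_exists b => /nd[w [fw Rzw]].
exists (fun y => R (y * w)); split=> //; split=> //.
- by move=> y y'; rewrite mulrDl RD.
- by move=> e y Ee; rewrite -mulrA RM.
- by move=> s y fs; rewrite -Rs // rmorphM /= fw.
Qed.

(** * Semilinear representations and partial equivariant functionals *)

Section Semilinear.

Variables (V : lmodType L) (rho : perm_of Psi -> V -> V).
Hypothesis Hrho : semirep (fun s => act s) rho.

Lemma rhoD s x y : rho s (x + y) = rho s x + rho s y.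
Proof. by case: Hrho. Qed.

Lemma rhoZ s a x : rho s (a *: x) = act s a *: rho s x.
Proof. by case: Hrho. Qed.

Lemma rho1 x : rho (perm_one Psi) x = x.
Proof. by case: Hrho. Qed.

Lemma rhoM s t x : rho (perm_mul s t) x = rho s (rho t x).
Proof. by case: Hrho. Qed.

Lemma rho0 s : rho s 0 = 0.
Proof. by rewrite -[X in rho s X](scale0r 0) rhoZ rmorph0 scale0r. Qed.

Lemma rho_sum s (T : Type) (r : seq T) (P : pred T) (F : T -> V) :
  rho s (\sum_(i <- r | P i) F i) = \sum_(i <- r | P i) rho s (F i).
Proof. by apply: big_morph => [x y|]; rewrite ?rhoD ?rho0. Qed.

Lemma rho_conj s g x : rho g (rho s x) = rho s (rho (perm_mul (perm_inv s) (perm_mul g s)) x).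
Proof. by rewrite -!rhoM perm_mulVK. Qed.

(** Smoothness is recorded vector by vector because the theory is later applied to a space of
    functions that may contain non-smooth vectors. *)
Definition smooth_vec (x : V) := exists S : seq Psi,
  forall s, fixes_pointwise S s -> rho s x = x.

Lemma smooth_vec0 : smooth_vec 0.
Proof. by exists [::] => s _; rewrite rho0. Qed.

Lemma smooth_vecP a x y : smooth_vec x -> smooth_vec y -> smooth_vec (a *: x + y).
Proof.
move=> [S fS] [S' fS']; have [S'' fS''] := gf_smooth gf a; exists (S ++ S' ++ S'').
move=> s /fixes_cat[/fS sx /fixes_cat[/fS' sy /fS'' sa]].
by rewrite rhoD rhoZ sx sy sa.
Qed.

Lemma smooth_vec_rho s x : smooth_vec x -> smooth_vec (rho s x).
Proof.
by move=> [S fS]; exists (map (pfun s) S) => g fg; rewrite rho_conj fS //; apply: fixes_conj.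
Qed.

Definition stable_sub I (U : V -> Prop) :=
  [/\ U 0, forall a x y, U x -> U y -> U (a *: x + y) &
      forall s x, fixes_pointwise I s -> U x -> U (rho s x)].

(** Graph of a linear functional on a subspace of smooth vectors, equivariant under the pointwise
    stabiliser of [I]. *)
Definition functional_graph I (H : V -> L -> Prop) :=
  [/\ H 0 0, forall a x y x' y', H x y -> H x' y' -> H (a *: x + x') (a * y + y'),
      forall s x y, fixes_pointwise I s -> H x y -> H (rho s x) (act s y),
      forall y, H 0 y -> y = 0 & forall x y, H x y -> smooth_vec x].

Definition gdom (H : V -> L -> Prop) (x : V) := exists y, H x y.

Definition gsub (H H' : V -> L -> Prop) := forall x y, H x y -> H' x y.

Lemma gdom_stable I H : functional_graph I H -> stable_sub I (gdom H).
Proof.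
move=> [H0 HP Hs _ _]; split; first by exists 0.
  by move=> a x x' [y Hy] [y' Hy']; exists (a * y + y'); apply: HP.
by move=> s x fs [y Hy]; exists (act s y); apply: Hs.
Qed.

Lemma functional_graph_fun I H x y y' :
  functional_graph I H -> H x y -> H x y' -> y = y'.
Proof.
move=> [_ HP _ H1 _] Hy Hy'; have := HP (-1) _ _ _ _ Hy Hy'.
by rewrite scaleN1r addNr mulN1r => /H1/eqP; rewrite addrC subr_eq0 => /eqP.
Qed.

Lemma functional_graph_sub I J H : {subset I <= J} ->
  functional_graph I H -> functional_graph J H.
Proof.
by move=> IJ [H0 HP Hs H1 Hsm]; split=> // s x y /(fixes_sub IJ); apply: Hs.
Qed.

Lemma stable_subD I U x y : stable_sub I U -> U x -> U y -> U (x + y).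
Proof. by move=> [_ UP _] Ux Uy; rewrite -[x]scale1r; apply: UP. Qed.

Lemma stable_subZ I U a x : stable_sub I U -> U x -> U (a *: x).
Proof. by move=> [U0 UP _] Ux; rewrite -[_ *: _]addr0; apply: UP. Qed.

Lemma stable_subB I U x y : stable_sub I U -> U x -> U y -> U (x - y).
Proof.
move=> Ust Ux Uy; apply: (stable_subD Ust) => //.
by rewrite -scaleN1r; apply: (stable_subZ _ Ust).
Qed.

Lemma stable_sub_sum I U (T : eqType) (r : seq T) (P : pred T) (F : T -> V) :
  stable_sub I U -> (forall i, i \in r -> P i -> U (F i)) -> U (\sum_(i <- r | P i) F i).
Proof.
move=> Ust UF; rewrite big_seq_cond; elim/big_ind: _ => [|x y|i /andP[]].
- by case: Ust.
- exact: (stable_subD Ust).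
- exact: UF.
Qed.

(* If [g b] is a generic point, [act g (R z)] does not depend on [g]: two choices
   differ by a transposition fixing everything that matters. *)
Lemma functional_average I b R H H0 :
  infinite_index Psi -> b \notin I -> averaging b R ->
  functional_graph (b :: I) H -> functional_graph I H0 -> gsub H0 H ->
  (forall e, supported_off act b e -> R e = e) \/ (forall x y, H0 x y -> y = 0) ->
  exists H', [/\ functional_graph I H', gsub H0 H' &
    forall x y A, H x y -> (forall s, fixes_pointwise (I ++ A) s -> rho s x = x) ->
      b \notin A -> H' x (R y)].
Proof.
move=> inf bI aR Hg H0g H0H HR; have [RD RM RE Rs] := aR.
have [H00 HP Hs H1 Hsm] := Hg.
(* The value at [x] is the common value of the averages over all [g] that fix [I] and send [b]
   outside some finite set [D]. *)
pose H' x y := smooth_vec x /\ exists D, forall g, fixes_pointwise I g ->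
  pfun g b \notin D -> exists z, H (rho (perm_inv g) x) z /\ y = act g (R z).
have offP g S : pfun g b \notin S -> b \notin map (pfun (perm_inv g)) S.
  by apply: contraNN => /mapP[i iS ->]; rewrite /= pinvK.
have off_inv g S a : pfun g b \notin S -> (forall s, fixes_pointwise S s -> act s a = a) ->
    supported_off act b (act (perm_inv g) a).
  move=> gS fS; exists (map (pfun (perm_inv g)) S); split; first exact: offP.
  move=> s /fixes_conj/fS e; by rewrite -[in RHS]e -!actM perm_mulVK.
exists H'; split.
- split.
  + split; first exact: smooth_vec0.
    exists [::] => g fg _; exists 0; rewrite rho0; split=> //.
    by rewrite (averaging0 aR) rmorph0.
  + move=> a x y x' y' [smx [D HD]] [smx' [D' HD']]; split; first exact: smooth_vecP.
    have [S fS] := gf_smooth gf a; exists (D ++ D' ++ S) => g fg.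
    rewrite !mem_cat !negb_or => /and3P[gD gD' gS].
    have [z [Hz ->]] := HD g fg gD; have [z' [Hz' ->]] := HD' g fg gD'.
    exists (act (perm_inv g) a * z + z'); split; first by rewrite rhoD rhoZ; apply: HP.
    by rewrite RD RM ?rmorphD ?rmorphM /= ?actKV //; apply: off_inv fS.
  + move=> s x y fs [smx [D HD]]; split; first exact: smooth_vec_rho.
    exists (map (pfun s) D) => g fg gD.
    have [||z [Hz ->]] := HD (perm_mul (perm_inv s) g).
    * by apply: fixes_mul fg; apply: fixes_inv.
    * by apply: contraNN gD => h; apply/mapP; exists (pinv s (pfun g b)); rewrite ?pinvK.
    exists z; split; last by rewrite actM actKV.
    rewrite -rhoM; have -> // : perm_mul (perm_inv g) s = perm_inv (perm_mul (perm_inv s) g).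
    exact: perm_ext.
  + move=> y [_ [D HD]]; have [g [fg gD]] := perm_move I [:: b] D inf.
    have [|z []] := HD g fg; first by apply: gD; rewrite ?mem_head.
    by rewrite rho0 => /H1 -> ->; rewrite (averaging0 aR) rmorph0.
  + by move=> x y [].
(* Once [g b] avoids a support of [y], the inverse translate of [y] does not involve [b] and is kept
   by a retraction; in the other alternative all values are 0. *)
- move=> x y H0xy; have [_ _ H0s _ H0sm] := H0g; split; first exact: H0sm H0xy.
  have [S fS] := gf_smooth gf y; exists S => g fg gS.
  exists (act (perm_inv g) y); split; first by apply/H0H/H0s => //; apply: fixes_inv.
  case: HR => [idR|zero]; first by rewrite idR ?actKV //; apply: off_inv fS.
  by rewrite (zero _ _ H0xy) rmorph0 (averaging0 aR) rmorph0.
move=> x y A Hxy fx bA; split; first exact: Hsm Hxy.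
exists A => g fg gA.
(* [h] fixes [x], and [c] fixes both [I] and [b], so [H] and [R] commute with [c]. What remains is
   that [h] fixes [R y]. *)
pose h := perm_swap b (pfun g b); pose c := perm_mul (perm_inv g) h.
have gbI : pfun g b \notin I.
  by apply: contraNN bI => /[dup] gbI /fg/pfun_inj <-.
have fh : fixes_pointwise (I ++ A) h by apply: fixes_swap; rewrite mem_cat negb_or ?bI ?gbI.
have fc : fixes_pointwise (b :: I) c.
  move=> i; rewrite inE => /predU1P[->|iI].
    by rewrite /c; change (pinv g (pfun h b) = b); rewrite /h perm_swapL pfunK.
  apply: fixes_mul iI; first exact: fixes_inv.
  by have /fixes_cat[] := fh.
have cx : rho (perm_inv g) x = rho c x by rewrite /c rhoM (fx h fh).
exists (act c y); split; first by rewrite cx; apply: Hs.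
rewrite Rs; last by apply: fixes_sub fc => i; rewrite !inE => ->.
rewrite -actM /c perm_mulVK.
have fy : forall s, fixes_pointwise (b :: I ++ A) s -> act s (R y) = R y.
  move=> s fs; rewrite -Rs; last by apply: fixes_sub fs => i; rewrite !inE => ->.
  congr R; apply: (functional_graph_fun Hg) (Hxy).
  rewrite -{1}(fx s); last by apply: fixes_sub fs => i; rewrite inE orbC => ->.
  apply: Hs => //; apply: fixes_sub fs => i; rewrite !inE mem_cat.
  by case/orP=> ->; rewrite ?orbT.
(* With a fresh point [j], the transposition [h] is a conjugate of [(b j)] by [(gb j)]. The first
   fixes [R y] since [Z] avoids [b] and [j], the second by [fy]. *)
have [Z [bZ fZ]] := RE y.
have [gbb|gbb] := eqVneq (pfun g b) b.
  rewrite fZ //; apply: fixes_swap => //; first by rewrite gbb.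
have [j] := inf (b :: pfun g b :: Z ++ I ++ A).
rewrite !inE !mem_cat !negb_or => /and5P[jb jgb jZ jI jA].
pose t := perm_swap (pfun g b) j; pose h' := perm_swap b j.
have ft : fixes_pointwise (b :: I ++ A) t.
  by apply: fixes_swap; rewrite !inE !mem_cat !negb_or ?gbb ?gbI ?gA ?jb ?jI ?jA.
have fh' : fixes_pointwise Z h' by apply: fixes_swap.
have -> : h = perm_mul t (perm_mul h' t).
  by apply: perm_swap_conj => //; rewrite eq_sym.
by rewrite !actM fy // fZ // fy.
Qed.

End Semilinear.
End GField.

(** * Extension of equivariant functionals *)

Section Generators.

Variables (Psi : eqType) (L : fieldType) (act : perm_of Psi -> {rmorphism L -> L}).
Variable var : Psi -> L.
Hypothesis gf : generic_gfield act var.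
Variables (V : lmodType L) (rho : perm_of Psi -> V -> V).
Hypothesis Hrho : semirep (fun s => act s) rho.
Implicit Types (I A B J : seq Psi) (s t g h : perm_of Psi).
Implicit Types (r : seq (L * perm_of Psi)) (U : V -> Prop) (H : V -> L -> Prop).

Definition preserves A g := {in A, forall i, pfun g i \in A}.

(** The condition makes a translate [rho g w], for [g] fixing [I], depend only on the set [g A], so
    translates are indexed by finite sets. *)
Definition set_generator I A w :=
  [/\ uniq A, {in A, forall i, i \notin I} &
      forall s, fixes_pointwise I s -> preserves A s -> rho s w = w].

Definition same_image A g h := perm_eq (map (pfun g) A) (map (pfun h) A).

Definition moves A g := ~~ perm_eq (map (pfun g) A) A.

Definition all_fix I r := {in r, forall p, fixes_pointwise I p.2}.

(** Total coefficient of [rho g w] after merging the terms whose permutations have the same image of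
    [A]. *)
Definition class_sum A r g := \sum_(p <- r | same_image A p.2 g) p.1.

Definition comb r w : V := \sum_(p <- r) p.1 *: rho p.2 w.

Lemma same_image_preserves A g h :
  same_image A g h -> preserves A (perm_mul (perm_inv h) g).
Proof.
move=> gh i iA; have : pfun g i \in map (pfun h) A by rewrite -(perm_mem gh) map_f.
by move=> /mapP[j jA e]; rewrite perm_mulE e /= pfunK.
Qed.

Lemma rho_same_image I A w g h :
  (forall s, fixes_pointwise I s -> preserves A s -> rho s w = w) ->
  fixes_pointwise I g -> fixes_pointwise I h -> same_image A g h ->
  rho g w = rho h w.
Proof.
move=> fw fg fh gh; rewrite -[g](perm_mulVK h) (rhoM Hrho) fw //.
  by apply: fixes_mul => //; apply: fixes_inv.
exact: same_image_preserves.
Qed.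

Lemma comb_split I A w r g :
  (forall s, fixes_pointwise I s -> preserves A s -> rho s w = w) ->
  all_fix I r -> fixes_pointwise I g ->
  comb r w = class_sum A r g *: rho g w +
             comb [seq p <- r | ~~ same_image A p.2 g] w.
Proof.
move=> fw fr fg; rewrite /comb (bigID (fun p => same_image A p.2 g)) /= big_filter.
congr (_ + _); rewrite scaler_suml big_seq_cond [RHS]big_seq_cond.
apply: eq_bigr => p /andP[pr same]; congr (_ *: _).
by apply: (rho_same_image fw _ fg same); apply: fr.
Qed.

(** The terms of one class add up to 0 and can be deleted without changing the other class sums, so
    induction on the length applies. *)
Lemma comb_cancel I A w r :
  (forall s, fixes_pointwise I s -> preserves A s -> rho s w = w) ->
  all_fix I r -> {in r, forall p, class_sum A r p.2 = 0} -> comb r w = 0.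
Proof.
move=> fw; elim: {r}(size r).+1 {-2}r (ltnSn (size r)) => // n IH r rn fr cr.
case: r rn fr cr => [|p r] rn fr cr; first by rewrite /comb big_nil.
have pr := mem_head p r.
rewrite (comb_split fw fr (fr _ pr)) cr // scale0r add0r.
apply: IH => [|q|q].
- rewrite -ltnS; apply: leq_trans rn; rewrite ltnS size_filter.
  rewrite -[X in (_ < X)%N]count_predT /= /same_image perm_refl add0n ltnS.
  exact: sub_count.
- by rewrite mem_filter => /andP[_]; apply: fr.
- rewrite mem_filter => /andP[qp qr]; rewrite -(cr q) // /class_sum big_filter_cond.
  apply: eq_bigl => q'; rewrite andb_idl // => q'q; apply: contraNN qp => q'p.
  by rewrite /same_image -(permPl q'q).
Qed.

Definition relation I A w U r :=
  [/\ all_fix I r, {in r, forall p, moves A p.2} & U (w + comb r w)].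

Lemma comb_rho g r w : rho g (comb r w) =
  comb [seq (act g p.1, perm_mul g p.2) | p <- r] w.
Proof.
rewrite /comb big_map (rho_sum Hrho); apply: eq_bigr => p _.
by rewrite (rhoZ Hrho) -(rhoM Hrho).
Qed.

Lemma comb_scale a r w : a *: comb r w = comb [seq (a * p.1, p.2) | p <- r] w.
Proof.
by rewrite /comb big_map scaler_sumr; apply: eq_bigr => p _; rewrite scalerA.
Qed.

Lemma comb_cat r r' w : comb (r ++ r') w = comb r w + comb r' w.
Proof. by rewrite /comb big_cat. Qed.

Lemma moves_translate A g h : ~~ same_image A h g -> moves A (perm_mul (perm_inv g) h).
Proof.
apply: contraNN => /(perm_map (pfun g)); rewrite -map_comp /same_image.
by rewrite (eq_map (g := pfun h)) // => i /=; rewrite pinvK.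
Qed.

(** If the class sum of [g] were nonzero, dividing by it and translating by the inverse of [g] would
    give a relation. *)
Lemma no_relation_class_sum I A w U r g : stable_sub rho I U ->
  (forall s, fixes_pointwise I s -> preserves A s -> rho s w = w) ->
  (forall r', ~ relation I A w U r') -> all_fix I r -> fixes_pointwise I g ->
  U (comb r w) -> class_sum A r g = 0.
Proof.
move=> Ust fw norel fr fg; rewrite (comb_split fw fr fg).
set c := class_sum A r g; set r0 := filter _ r => Uc.
have [//|c0] := eqVneq c 0; have [_ _ Us] := Ust.
have := Us _ _ (fixes_inv fg) (stable_subZ c^-1 Ust Uc).
rewrite scalerDr scalerA mulVf // scale1r comb_scale (rhoD Hrho) comb_rho -(rhoM Hrho).
have -> : perm_mul (perm_inv g) g = perm_one Psi by apply: perm_ext => i /=; rewrite pfunK.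
rewrite (rho1 Hrho) -map_comp => Uw; exfalso; apply: norel; split; last exact: Uw.
- move=> _ /mapP[p + ->] /=; rewrite mem_filter => /andP[_ /fr fp].
  by apply: fixes_mul => //; apply: fixes_inv.
- move=> _ /mapP[p + ->] /=; rewrite mem_filter => /andP[np _].
  exact: moves_translate.
Qed.

Lemma set_generator_fixed I A w s : set_generator I A w ->
  fixes_pointwise (I ++ A) s -> rho s w = w.
Proof.
by move=> [_ _ fw] /fixes_cat[fI fA]; apply: fw => // i iA; rewrite fA.
Qed.

Lemma set_generator_smooth I A w : set_generator I A w -> smooth_vec rho w.
Proof. by move=> gw; exists (I ++ A) => s; apply: set_generator_fixed gw. Qed.

Lemma comb_smooth r w : smooth_vec rho w -> smooth_vec rho (comb r w).
Proof.
move=> smw; rewrite /comb; elim: r => [|p r IH].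
  by rewrite big_nil; exact: (smooth_vec0 Hrho).
rewrite big_cons; apply: (smooth_vecP gf Hrho) => //.
exact: (smooth_vec_rho Hrho).
Qed.

Lemma comb_stable I U r w : stable_sub rho I U -> all_fix I r -> U w -> U (comb r w).
Proof.
move=> Ust fr Uw; apply: (stable_sub_sum Ust) => p /fr fp _.
by apply: (stable_subZ _ Ust); case: Ust => _ _; apply.
Qed.

(** A permutation that fixes [J] and preserves the part of [g A] outside [J] preserves [g A]; its
    conjugate by [g] preserves [A]. *)
Lemma gen_translate I J A w g : set_generator I A w -> {subset I <= J} ->
  fixes_pointwise I g ->
  set_generator J [seq i <- map (pfun g) A | i \notin J] (rho g w).
Proof.
move=> [uA AI fw] IJ fg; split.
- by rewrite filter_uniq // map_inj_uniq //; exact: pfun_inj.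
- by move=> i; rewrite mem_filter => /andP[].
- move=> s fs ps; rewrite (rho_conj Hrho) fw //.
    apply: fixes_mul; first exact: fixes_inv.
    by apply: fixes_mul => //; exact: fixes_sub fs.
  move=> i iA; rewrite !perm_mulE.
  have iA' : pfun g i \in map (pfun g) A by apply: map_f.
  have : pfun s (pfun g i) \in map (pfun g) A.
    have [iJ|iJ] := boolP (pfun g i \in J); first by rewrite fs.
    have := ps (pfun g i); rewrite !mem_filter iJ iA' => /(_ isT).
    by case/andP.
  by move=> /mapP[j jA ->] /=; rewrite pfunK.
Qed.

Lemma moves_outside A g : uniq A -> moves A g -> exists2 i, i \in A & pfun g i \notin A.
Proof.
move=> uA mv; have ugA : uniq (map (pfun g) A) by rewrite map_inj_uniq //; exact: pfun_inj.
apply: contrapT => no; move/negP: mv; apply; apply: uniq_perm => //.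
have sub : {subset map (pfun g) A <= A}.
  move=> _ /mapP[i iA ->]; apply: contrapT => /negP h; apply: no.
  by exists i.
by have [|_ e] := uniq_min_size ugA sub; rewrite ?size_map.
Qed.

Definition new_points A r :=
  [seq i <- flatten [seq map (pfun p.2) A | p <- r] | i \notin A].

Lemma new_pointsP A r i : reflect
  (exists p, [/\ p \in r, i \in map (pfun p.2) A & i \notin A]) (i \in new_points A r).
Proof.
rewrite mem_filter; apply: (iffP andP) => [[iA /flattenP[_ /mapP[p pr ->] ip]]|].
  by exists p.
by move=> [p [pr ip iA]]; split=> //; apply/flattenP; exists (map (pfun p.2) A) => //;
   apply/mapP; exists p.
Qed.

(** Some point of the moved set lies outside [A], hence in [J], and drops out of the relative
    support. This decrease drives both later inductions. *)
Lemma size_new_gen A r J p : uniq A -> p \in r -> moves A p.2 ->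
  {subset new_points A r <= J} ->
  (size [seq i <- map (pfun p.2) A | i \notin J] < size A)%N.
Proof.
move=> uA pr /(moves_outside uA)[i iA giA] BJ.
rewrite size_filter -[X in (_ < X)%N](size_map (pfun p.2)).
rewrite -(count_predC (fun i => i \notin J)) -[X in (X < _)%N]addn0 ltn_add2l.
rewrite -has_count; apply/hasP; exists (pfun p.2 i); first exact: map_f.
by rewrite /= negbK; apply: BJ; apply/new_pointsP; exists p; rewrite map_f.
Qed.

Lemma set_generator_sub I J A w : set_generator I A w -> {subset I <= J} ->
  {in A, forall i, i \notin J} -> set_generator J A w.
Proof. by move=> [uA _ fw] IJ AJ; split=> // s /(fixes_sub IJ); apply: fw. Qed.

End Generators.

Section Extension.

Variables (Psi : eqType) (L : fieldType) (act : perm_of Psi -> {rmorphism L -> L}).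
Variable var : Psi -> L.
Hypothesis gf : generic_gfield act var.
Variables (V : lmodType L) (rho : perm_of Psi -> V -> V).
Hypothesis Hrho : semirep (fun s => act s) rho.
Implicit Types (I A B J : seq Psi) (s t g h : perm_of Psi).
Implicit Types (r : seq (L * perm_of Psi)) (U : V -> Prop) (H : V -> L -> Prop).

Let actV s : L^o -> L^o := act s.

(** Lets the lemmas on combinations of translates be applied to scalars as well as to vectors. *)
Lemma semirep_regular : semirep (fun s => act s) actV.
Proof.
split=> [s x y|s a x|x|s t x]; rewrite /actV.
- exact: rmorphD.
- exact: rmorphM.
- exact: (gf_one gf).
- exact: (gf_mul gf).
Qed.

Lemma functional_graph_comb I H w q r : functional_graph act rho I H ->
  H w q -> all_fix I r -> H (comb rho r w) (\sum_(p <- r) p.1 * act p.2 q).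
Proof.
move=> [H0 HP Hs _ _] Hw; rewrite /comb; elim: r => [|p r IH] fr.
  by rewrite !big_nil.
rewrite !big_cons; apply: HP; first by apply: Hs => //; apply: fr; rewrite mem_head.
by apply: IH => p' pr; apply: fr; rewrite inE pr orbT.
Qed.

(** Without relations the distinct translates of [w] are independent modulo the domain, so any [q]
    with the symmetries of [w] may be prescribed as its value. *)
Lemma functional_adjoin I H A w q : functional_graph act rho I H ->
  set_generator rho I A w ->
  (forall s, fixes_pointwise I s -> preserves A s -> act s q = q) ->
  (forall r, ~ relation rho I A w (gdom H) r) ->
  exists H', [/\ functional_graph act rho I H', gsub H H' & H' w q].
Proof.
move=> Hg gw fq norel; have [uA AI fw] := gw; have [H0 HP Hs H1 Hsm] := Hg.
pose ev r := \sum_(p <- r) p.1 * act p.2 q.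
pose H' x y := exists x' y' r,
  [/\ H x' y', all_fix I r, x = x' + comb rho r w & y = y' + ev r].
have H'i x y r : H x y -> all_fix I r -> H' (x + comb rho r w) (y + ev r).
  by move=> Hxy fr; exists x, y, r.
exists H'; split=> //; last first.
- have := H'i _ _ [:: (1, perm_one Psi)] H0.
  rewrite /comb /ev !big_seq1 /= !add0r scale1r mul1r (rho1 Hrho) (gf_one gf).
  by apply=> p; rewrite inE => /eqP->.
- move=> x y Hxy; have := H'i x y [::] Hxy.
  by rewrite /comb /ev !big_nil !addr0; apply.
split.
- exists 0, 0, [::]; split=> //; first by rewrite /comb big_nil addr0.
  by rewrite /ev big_nil addr0.
- move=> a _ _ _ _ [x [y [r [Hxy fr -> ->]]]] [x' [y' [r' [Hxy' fr' -> ->]]]].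
  exists (a *: x + x'), (a * y + y'), ([seq (a * p.1, p.2) | p <- r] ++ r'); split.
  + exact: HP.
  + by move=> p; rewrite mem_cat => /orP[/mapP[p' /fr + ->]|/fr'].
  + by rewrite comb_cat -comb_scale scalerDr addrACA.
  + rewrite /ev big_cat big_map /= mulrDr addrACA mulr_sumr.
    by congr (_ + (_ + _)); apply: eq_bigr => p _; rewrite mulrA.
- move=> g _ _ fg [x [y [r [Hxy fr -> ->]]]].
  exists (rho g x), (act g y), [seq (act g p.1, perm_mul g p.2) | p <- r]; split.
  + exact: Hs.
  + by move=> _ /mapP[p /fr fp ->]; apply: fixes_mul.
  + by rewrite (rhoD Hrho) (comb_rho Hrho).
  + rewrite rmorphD /ev rmorph_sum big_map; congr (_ + _); apply: eq_bigr => p _.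
    by rewrite rmorphM /= (gf_mul gf).
- move=> _ [x [y [r [Hxy fr + ->]]]] => /esym/eqP.
  rewrite addrC addr_eq0 => /eqP e.
  (* Well-definedness: a combination of translates lying in the domain has zero class sums, so it
     vanishes together with its prescribed value. *)
  have domN : gdom H (comb rho r w).
    by rewrite e -scaleN1r; apply: stable_subZ (gdom_stable Hg) _; exists y.
  have cl g : fixes_pointwise I g -> class_sum A r g = 0.
    by move=> fg; apply: (no_relation_class_sum Hrho) (gdom_stable Hg) fw norel fr fg domN.
  have ev0 : ev r = 0.
    apply: (comb_cancel semirep_regular (I := I) (A := A)) => //.
    by move=> p /fr/cl.
  rewrite ev0 addr0; apply: H1.
  have : comb rho r w = 0 by apply: (comb_cancel Hrho fw fr) => p pr; apply/cl/fr.
  by rewrite e => /eqP; rewrite oppr_eq0 => /eqP x0; rewrite x0 in Hxy.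
- move=> _ _ [x [y [r [Hxy fr -> _]]]]; rewrite -[x]scale1r.
  apply: (smooth_vecP gf Hrho); first exact: Hsm Hxy.
  exact/(comb_smooth gf Hrho)/(set_generator_smooth gw).
Qed.

End Extension.

(* The witness is the expansion of the product over [t] of
   [(x_t - chi_t x_t) / (chi_t0 x_t - chi_t x_t)]. *)
Lemma dedekind_dual (L : fieldType) (D : L -> Prop) (T : eqType)
    (chi : T -> {rmorphism L -> L}) (t0 : T) (ts : seq T) :
  D 1 -> (forall a b, D a -> D b -> D (a * b)) ->
  {in ts, forall t, exists2 x, D x & chi t x != chi t0 x} ->
  exists r : seq (L * L), [/\ {in r, forall p, D p.2},
    \sum_(p <- r) p.1 * chi t0 p.2 = 1 &
    {in ts, forall t, \sum_(p <- r) p.1 * chi t p.2 = 0}].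
Proof.
move=> D1 DM; elim: ts => [|t ts IH] sep.
  exists [:: (1, 1)]; split=> //; first by move=> p; rewrite inE => /eqP->.
  by rewrite big_seq1 /= rmorph1 mulr1.
have [u uts|r [rD r1 r0]] := IH; first by apply: sep; rewrite inE uts orbT.
have [x Dx ne] := sep t (mem_head _ _).
pose d := chi t0 x - chi t x.
have d0 : d != 0 by rewrite subr_eq0 eq_sym.
exists ([seq (p.1 / d, x * p.2) | p <- r] ++ [seq (- chi t x * p.1 / d, p.2) | p <- r]).
have ev u : \sum_(p <- [seq (p.1 / d, x * p.2) | p <- r] ++
    [seq (- chi t x * p.1 / d, p.2) | p <- r]) p.1 * chi u p.2 =
    (chi u x - chi t x) / d * \sum_(p <- r) p.1 * chi u p.2.
  rewrite big_cat !big_map /= mulrBl mulrBl !mulr_sumr -sumrN.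
  congr (_ + _); apply: eq_bigr => p _.
    by rewrite rmorphM /= mulrA mulrA; congr (_ * _); rewrite mulrAC [p.1 * _]mulrC mulrAC.
  by rewrite !mulNr !mulrA; congr (- (_ * _)); rewrite mulrAC.
split.
- by move=> p; rewrite mem_cat => /orP[] /mapP[q qr ->] /=; [apply: DM => //|]; apply: rD.
- by rewrite ev r1 mulr1 divff.
- move=> u; rewrite inE ev => /predU1P[->|/r0->]; last by rewrite mulr0.
  by rewrite subrr !mul0r.
Qed.

Section Extension.

Variables (Psi : eqType) (L : fieldType) (act : perm_of Psi -> {rmorphism L -> L}).
Variable var : Psi -> L.
Hypothesis gf : generic_gfield act var.
Variables (V : lmodType L) (rho : perm_of Psi -> V -> V).
Hypothesis Hrho : semirep (fun s => act s) rho.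
Implicit Types (I A B J S : seq Psi) (s t g h : perm_of Psi).
Implicit Types (r : seq (L * perm_of Psi)) (U : V -> Prop) (H : V -> L -> Prop).

Lemma sub_cat_r B I : {subset I <= B ++ I}.
Proof. by move=> i iI; rewrite mem_cat iI orbT. Qed.

(** The points of [B] are averaged away one by one; a point that still occurs in the rest of the
    list needs no averaging. *)
Lemma functional_average_seq B I H H0 : infinite_index Psi ->
  functional_graph act rho (B ++ I) H -> functional_graph act rho I H0 -> gsub H0 H ->
  exists H', [/\ functional_graph act rho I H', gsub H0 H' &
    forall x A, gdom H x -> (forall s, fixes_pointwise (I ++ A) s -> rho s x = x) ->
      {in B, forall b, b \notin A} -> gdom H' x].
Proof.
move=> inf; elim: B H => [|b B IH] H Hg H0g H0H; first by exists H.
have H0g' := functional_graph_sub (@sub_cat_r B I) H0g.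
have [H1 [H1g H01 H1d]] : exists H1, [/\ functional_graph act rho (B ++ I) H1,
    gsub H0 H1 & forall x A, gdom H x ->
      (forall s, fixes_pointwise (I ++ A) s -> rho s x = x) ->
      b \notin A -> gdom H1 x].
  have [bBI|bBI] := boolP (b \in B ++ I).
    exists H; split=> //; apply: functional_graph_sub Hg => i.
    by rewrite /= inE => /predU1P[->|].
  have [R [aR idR]] := averaging_retraction gf b.
  have [H1 [H1g H01 H1d]] := functional_average gf Hrho inf bBI aR Hg H0g' H0H (or_introl idR).
  exists H1; split=> // x A [y Hxy] fx bA; exists (R y); apply: H1d Hxy _ bA.
  move=> s fs; apply: fx; apply: fixes_sub fs => i.
  by rewrite !mem_cat => /orP[]->; rewrite ?orbT.
have [H' [H'g H0H' H'd]] := IH _ H1g H0g H01.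
exists H'; split=> // x A Hx fx BA; apply: (H'd _ A) => //.
  by apply: (H1d _ A) => //; apply: BA; rewrite mem_head.
by move=> c cB; apply: BA; rewrite inE cB orbT.
Qed.

(** Only the zero functional on the zero space has to be preserved, which allows at each point an
    operator chosen not to kill the current value at [x]. *)
Lemma functional_average_nonzero B I H x y A : infinite_index Psi ->
  functional_graph act rho (B ++ I) H -> H x y -> y != 0 ->
  (forall s, fixes_pointwise (I ++ A) s -> rho s x = x) ->
  {in B, forall b, b \notin A} ->
  exists H', functional_graph act rho I H' /\ exists2 y', H' x y' & y' != 0.
Proof.
move=> inf; elim: B H y => [|b B IH] H y Hg Hxy y0 fx BA.
  by exists H; split=> //; exists y.
have BA' : {in B, forall b, b \notin A} by move=> c cB; apply: BA; rewrite inE cB orbT.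
have [bBI|bBI] := boolP (b \in B ++ I).
  apply: (IH H y) => //; apply: functional_graph_sub Hg => i.
  by rewrite /= inE => /predU1P[->|].
have [R [aR R0]] := averaging_nonzero gf b y0.
pose H0 (v : V) (a : L) := v = 0 /\ a = 0.
have [H00 HP Hs H1 Hsm] := Hg.
have H0g : functional_graph act rho (B ++ I) H0.
  split=> //.
  - by move=> a _ _ _ _ [-> ->] [-> ->]; rewrite /H0 scaler0 mulr0 !addr0.
  - by move=> s _ _ _ [-> ->]; rewrite /H0 (rho0 Hrho) rmorph0.
  - by move=> a [].
  - by move=> _ _ [-> _]; apply: smooth_vec0 Hrho.
have [||H' [H'g _ H'd]] := functional_average gf Hrho inf bBI aR Hg H0g.
- by move=> _ _ [-> ->].
- by right=> v a [].
apply: (IH H' (R y)) => //; apply: H'd Hxy _ (BA _ (mem_head _ _)).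
move=> s fs; apply: fx; apply: fixes_sub fs => i.
by rewrite !mem_cat => /orP[]->; rewrite ?orbT.
Qed.

(* Induction on the size of the support.  Without a relation, extend by [0].  A
   relation expresses [w] through generators with smaller support relative to the
   stabiliser of the new points; extend there, then average over the new points. *)
Lemma functional_extend_gen n I H A w : (size A <= n)%N ->
  n = 0%N \/ infinite_index Psi ->
  functional_graph act rho I H -> set_generator rho I A w ->
  exists H', [/\ functional_graph act rho I H', gsub H H' & gdom H' w].
Proof.
elim: n I H A w => [|n IH] I H A w sA ninf Hg gw; have [uA AI fw] := gw;
  have [[r [fr mr dr]]|norel] := pselect (exists r, relation rho I A w (gdom H) r).
(* Here [A] is empty and no permutation moves it, so the relation has no terms and [w] is already in
   the domain. *)
- case: r fr mr dr => [|p r] fr mr dr.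
    by exists H; split=> //; move: dr; rewrite /comb big_nil addr0.
  by move: sA (mr p (mem_head _ _)); rewrite leqn0 /moves => /nilP->.
- have [|r rel|H' [H'g HH' H'w]] := functional_adjoin gf Hrho (q := 0) Hg gw.
  + by move=> s _ _; rewrite rmorph0.
  + by apply: norel; exists r.
  by exists H'; split=> //; exists 0.
- case: ninf => // inf; pose B := new_points A r; pose J := B ++ I.
  have IJ : {subset I <= J} by apply: sub_cat_r.
  have [H1 [H1g HH1 H1d]] : exists H1, [/\ functional_graph act rho J H1, gsub H H1 &
      {in r, forall p, gdom H1 (rho p.2 w)}].
    have: {subset r <= r} by [].
    elim: {1 3}r => [|p r' IHr] sub.
      by exists H; split=> //; apply: functional_graph_sub Hg.
    have [p' pr'|H1 [H1g HH1 H1d]] := IHr; first by apply: sub; rewrite inE pr' orbT.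
    have pr := sub p (mem_head _ _).
    have [|H2 [H2g H12 H2d]] := IH J H1 _ _ _ (or_intror inf) H1g
        (gen_translate Hrho gw IJ (fr _ pr)).
      rewrite -ltnS; apply: leq_trans sA; apply: (size_new_gen uA pr (mr _ pr)).
      by move=> i iB; rewrite mem_cat iB.
    exists H2; split=> // [x y /HH1/H12|p'] //.
    by rewrite inE => /predU1P[->//|/H1d[y /H12]]; exists y.
  (* The relation puts [w] plus a combination into the domain, and every translate in that
     combination is there by now. *)
  have w1 : gdom H1 w.
    rewrite -(addrK (comb rho r w) w); apply: (stable_subB (gdom_stable H1g)).
      by have [y /HH1] := dr; exists y.
    apply: (stable_sub_sum (gdom_stable H1g)) => p pr _.
    by apply: (stable_subZ _ (gdom_stable H1g)); apply: H1d.
  have [H' [H'g HH' H'd]] := functional_average_seq inf H1g Hg HH1.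
  exists H'; split=> //; apply: (H'd _ A) => //.
    by move=> s; apply: set_generator_fixed gw.
  by move=> b /new_pointsP[p []].
- have [|r rel|H' [H'g HH' H'w]] := functional_adjoin gf Hrho (q := 0) Hg gw.
  + by move=> s _ _; rewrite rmorph0.
  + by apply: norel; exists r.
  by exists H'; split=> //; exists 0.
Qed.

End Extension.

(** * Separation of vectors *)

Section Separation.

Variables (Psi : eqType) (L : fieldType) (act : perm_of Psi -> {rmorphism L -> L}).
Variable var : Psi -> L.
Hypothesis gf : generic_gfield act var.
Variables (V : lmodType L) (rho : perm_of Psi -> V -> V).
Hypothesis Hrho : semirep (fun s => act s) rho.
Implicit Types (I A B J S : seq Psi) (s t g h : perm_of Psi).
Implicit Types (r : seq (L * perm_of Psi)) (U : V -> Prop) (H : V -> L -> Prop).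
Implicit Types (us ts ls : seq (seq Psi * V)).

Lemma act_sum_var s X : act s (\sum_(i <- X) var i) = \sum_(i <- map (pfun s) X) var i.
Proof. by rewrite rmorph_sum big_map; apply: eq_bigr => i _; rewrite (gf_var gf). Qed.

(** Exchanging a point of [X] outside [Y] with a fresh point fixes the sum over [Y] but changes the
    sum over [X]. Thus symmetric sums of variables distinguish finite sets. *)
Lemma sum_var_inj X Y : infinite_index Psi -> uniq X -> uniq Y ->
  \sum_(i <- X) var i = \sum_(i <- Y) var i -> perm_eq X Y.
Proof.
move=> inf; have sub X' Y' : uniq X' -> \sum_(i <- X') var i = \sum_(i <- Y') var i ->
    {subset X' <= Y'}.
  move=> uX e i iX; apply: contrapT => /negP iY.
  have [j] := inf (X' ++ Y'); rewrite mem_cat negb_or => /andP[jX jY].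
  have ij : i != j by apply: contraNneq jX => <-.
  have fixrem : map (pfun (perm_swap i j)) (rem i X') = rem i X'.
    apply: map_id_in => k; rewrite mem_rem_uniq // inE => /andP[ki kX].
    by apply: perm_swapD => //; apply: contraNneq jX => <-.
  have := congr1 (act (perm_swap i j)) e; rewrite !act_sum_var.
  have -> : map (pfun (perm_swap i j)) Y' = Y'.
    apply: map_id_in => k kY.
    by apply: perm_swapD; [apply: contraNneq iY|apply: contraNneq jY] => <-.
  rewrite -e (perm_big _ (perm_map _ (perm_to_rem iX))) map_cons fixrem perm_swapL.
  rewrite (perm_big _ (perm_to_rem iX)) !big_cons.
  by move=> /addIr/(gf_inj gf)/esym/eqP; rewrite (negPf ij).
move=> uX uY e; apply: uniq_perm => // i.
by apply/idP/idP; [apply: (sub X Y)|apply: (sub Y X)].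
Qed.

Definition gens_ok I us := {in us, forall p, set_generator rho I p.1 p.2}.

(** Impredicative span, so that properties of its elements follow by exhibiting a stable
    subspace. *)
Definition gspan I us x := forall U, stable_sub rho I U ->
  {in us, forall p, U p.2} -> U x.

Lemma gspan_stable I us : stable_sub rho I (gspan I us).
Proof.
split.
- by move=> U [].
- by move=> a x y Hx Hy U Ust Uus; have [_ UP _] := Ust; apply: UP; [apply: Hx|apply: Hy].
- by move=> s x fs Hx U Ust Uus; have [_ _ Us] := Ust; apply: Us => //; apply: Hx.
Qed.

Lemma gspan_gen I us p : p \in us -> gspan I us p.2.
Proof. by move=> pus U _; apply. Qed.

Lemma gspan_trans I us us' x : {in us, forall p, gspan I us' p.2} ->
  gspan I us x -> gspan I us' x.
Proof. by move=> uus; apply=> //; apply: gspan_stable. Qed.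

Lemma gspan_sub I us us' x : {subset us <= us'} -> gspan I us x -> gspan I us' x.
Proof. by move=> sub; apply: gspan_trans => p /sub; apply: gspan_gen. Qed.

Lemma gspan_cons I p us x : gspan I (p :: us) x ->
  exists x' r, [/\ gspan I us x', all_fix I r & x = x' + comb rho r p.2].
Proof.
move=> Hx; pattern x; apply: Hx.
- split.
  + exists 0, [::]; split=> //; first by case: (gspan_stable I us).
    by rewrite /comb big_nil addr0.
  + move=> a _ _ [x' [r [Hx' fr ->]]] [y' [r' [Hy' fr' ->]]].
    exists (a *: x' + y'), ([seq (a * p.1, p.2) | p <- r] ++ r'); split.
    * by have [_ UP _] := gspan_stable I us; apply: UP.
    * by move=> q; rewrite mem_cat => /orP[/mapP[q' /fr + ->]|/fr'].
    * by rewrite comb_cat -comb_scale scalerDr addrACA.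
  + move=> g _ fg [x' [r [Hx' fr ->]]].
    exists (rho g x'), [seq (act g p.1, perm_mul g p.2) | p <- r]; split.
    * by have [_ _ Us] := gspan_stable I us; apply: Us.
    * by move=> _ /mapP[q /fr fq ->]; apply: fixes_mul.
    * by rewrite (rhoD Hrho) (comb_rho Hrho).
- move=> q; rewrite inE => /predU1P[->|qus].
  + exists 0, [:: (1, perm_one Psi)]; split.
    * by case: (gspan_stable I us).
    * by move=> q'; rewrite inE => /eqP->.
    * by rewrite /comb big_seq1 /= scale1r (rho1 Hrho) add0r.
  + exists q.2, [::]; split=> //; first exact: gspan_gen.
    by rewrite /comb big_nil addr0.
Qed.

Lemma gspan_smooth I us x : gens_ok I us -> gspan I us x -> smooth_vec rho x.
Proof.
move=> gus; apply; last by move=> p /gus; apply: set_generator_smooth.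
split; first exact: smooth_vec0 Hrho.
  exact: (smooth_vecP gf Hrho).
by move=> s y _; apply: (smooth_vec_rho Hrho).
Qed.

(* Only translates meeting [J] fail to be [J]-translates of the given generators,
   and relative to [J] these have a smaller support. *)
Lemma gspan_refine I J us x : gens_ok I us -> {subset I <= J} ->
  {in us, forall p, {in p.1, forall i, i \notin J}} -> gspan I us x ->
  exists new, [/\ gens_ok J new,
    {in new, forall q, exists2 p, p \in us & (size q.1 < size p.1)%N} &
    gspan J (us ++ new) x].
Proof.
move=> gus IJ usJ Hx.
(* Quantifying over all translates makes the property stable under the stabiliser of [I], as
   induction on the span requires. *)
have : forall h, fixes_pointwise I h -> exists new, [/\ gens_ok J new,
    {in new, forall q, exists2 p, p \in us & (size q.1 < size p.1)%N} &
    gspan J (us ++ new) (rho h x)]; last first.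
  by move=> /(_ _ (@fixes_one _ I)); rewrite (rho1 Hrho).
pattern x; apply: Hx.
- split.
  + move=> h fh; exists [::]; split=> //; rewrite (rho0 Hrho).
    by case: (gspan_stable J (us ++ [::])).
  + move=> a y z Hy Hz h fh.
    have [n1 [g1 s1 y1]] := Hy h fh; have [n2 [g2 s2 z2]] := Hz h fh.
    exists (n1 ++ n2); split.
    * by move=> q; rewrite mem_cat => /orP[/g1|/g2].
    * by move=> q; rewrite mem_cat => /orP[/s1|/s2].
    * rewrite (rhoD Hrho) (rhoZ Hrho).
      have [_ UP _] := gspan_stable J (us ++ n1 ++ n2); apply: UP.
        by apply: gspan_sub y1 => p; rewrite !mem_cat => /orP[]->; rewrite ?orbT.
      by apply: gspan_sub z2 => p; rewrite !mem_cat => /orP[]->; rewrite ?orbT.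
  + by move=> s y fs Hy h fh; rewrite -(rhoM Hrho); apply: Hy; apply: fixes_mul.
move=> [A w] pus h fh /=; have gw := gus _ pus; have [/= uA AI fw] := gw.
have AJ := usJ _ pus; rewrite /= in AJ.
have [/hasP[_ /mapP[i iA ->] hiJ]|/hasPn off] := boolP (has (mem J) (map (pfun h) A)).
  exists [:: ([seq i <- map (pfun h) A | i \notin J], rho h w)]; split.
  - by move=> q; rewrite inE => /eqP->; apply: (gen_translate Hrho gw IJ fh).
  - move=> q; rewrite inE => /eqP->; exists (A, w) => //=.
    rewrite size_filter -[X in (_ < X)%N](size_map (pfun h)).
    rewrite -(count_predC (fun i => i \notin J)) -[X in (X < _)%N]addn0 ltn_add2l.
    by rewrite -has_count; apply/hasP; exists (pfun h i);
      [exact: map_f|rewrite /= negbK].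
  - apply: (@gspan_gen J _ ([seq i <- map (pfun h) A | i \notin J], rho h w)).
    by rewrite mem_cat mem_head orbT.
exists [::]; split=> //; rewrite cats0.
(* When [h A] avoids [J], some [c] fixes [J] and agrees with [h] on [A], so [rho h w] is also a
   translate by the smaller group. *)
have [c fc] : exists c, {in J ++ A, pfun c =1 fun i => if i \in A then pfun h i else i}.
  apply: perm_extension => i j; rewrite !mem_cat.
  case: ifPn => iA; case: ifPn => jA; rewrite ?orbT ?orbF => iJ jJ //.
  - exact: pfun_inj.
  - by move=> e; have := off _ (map_f (pfun h) iA); rewrite /= e jJ.
  - by move=> e; have := off _ (map_f (pfun h) jA); rewrite /= -e iJ.
have fcJ : fixes_pointwise J c.
  by move=> i iJ; rewrite fc ?mem_cat ?iJ //; case: ifP => // /AJ; rewrite iJ.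
have -> : rho h w = rho c w.
  apply: (rho_same_image Hrho fw) => //; first exact: fixes_sub fcJ.
  rewrite /same_image (_ : map (pfun c) A = map (pfun h) A) //.
  by apply/eq_in_map => i iA; rewrite fc ?mem_cat ?iA ?orbT.
by have [_ _ Us] := gspan_stable J us; apply: Us => //; apply: (@gspan_gen J _ (A, w)).
Qed.

(** If every invariant [q] gave 0, the linear independence of the embeddings [act g] of the field of
    such [q] would kill all class sums. The sum of the variables over [A] separates these
    embeddings. *)
Lemma comb_detect I A w r : A = [::] \/ infinite_index Psi ->
  set_generator rho I A w -> all_fix I r -> comb rho r w != 0 ->
  exists2 q, (forall s, fixes_pointwise I s -> preserves A s -> act s q = q) &
    \sum_(p <- r) p.1 * act p.2 q != 0.
Proof.
move=> Ainf [uA AI fw] fr c0; apply: contrapT => noq.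
have van q : (forall s, fixes_pointwise I s -> preserves A s -> act s q = q) ->
    \sum_(p <- r) p.1 * act p.2 q = 0.
  by move=> fq; apply/eqP/negPn/negP => ne; apply: noq; exists q.
move/eqP: c0; apply; apply: (comb_cancel Hrho fw fr) => p0 p0r.
set g := p0.2; have fg : fixes_pointwise I g by apply: fr.
pose D q := forall s, fixes_pointwise I s -> preserves A s -> act s q = q.
have [| |t|ds [dsD ds1 ds0]] := @dedekind_dual L D _ act g
    [seq p.2 | p <- [seq p <- r | ~~ same_image A p.2 g]].
- by move=> s _ _; rewrite rmorph1.
- by move=> a b Da Db s fs ps; rewrite rmorphM /= Da ?Db.
- move=> /mapP[p + ->]; rewrite mem_filter => /andP[np _].
  case: Ainf => [A0|inf]; first by rewrite A0 in np.
  exists (\sum_(i <- A) var i).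
    move=> s fs ps; rewrite act_sum_var; apply: perm_big.
    have us : uniq (map (pfun s) A) by rewrite map_inj_uniq //; exact: pfun_inj.
    apply: uniq_perm => //.
    have sub : {subset map (pfun s) A <= A} by move=> _ /mapP[i iA ->]; apply: ps.
    by have [|_ e] := uniq_min_size us sub; rewrite ?size_map.
  rewrite !act_sum_var; apply: contraNneq np; apply: sum_var_inj => //;
    by rewrite map_inj_uniq //; exact: pfun_inj.
(* Pairing the vanishing sums with the dual combination isolates the class sum of [g]. *)
have : \sum_(d <- ds) d.1 * \sum_(p <- r) p.1 * act p.2 d.2 = 0.
  by rewrite big_seq big1 // => d dds; rewrite (van _ (dsD _ dds)) mulr0.
have spl d : d \in ds -> \sum_(p <- r) p.1 * act p.2 d.2 =
    class_sum A r g * act g d.2 +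
    \sum_(p <- [seq p <- r | ~~ same_image A p.2 g]) p.1 * act p.2 d.2.
  by move=> dds; apply: (comb_split (semirep_regular gf) (w := d.2) (dsD _ dds) fr fg).
rewrite big_seq (eq_bigr _ (fun d dds => congr1 _ (spl d dds))) -big_seq.
under eq_bigr do rewrite mulrDr mulrCA.
rewrite big_split /= -mulr_sumr ds1 mulr1.
rewrite [X in _ + X](_ : _ = 0) ?addr0 //.
under eq_bigr do rewrite mulr_sumr.
rewrite exchange_big /= big_seq big1 // => p pr.
under eq_bigr do rewrite mulrCA.
by rewrite -mulr_sumr ds0 ?mulr0 //; apply: map_f.
Qed.

(** The relation is translated by a permutation that fixes [I] and [A], hence [w], and carries the
    new points away from [D]. *)
Lemma relation_move I A w U r (D : seq Psi) : infinite_index Psi -> stable_sub rho I U ->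
  set_generator rho I A w -> relation rho I A w U r ->
  exists r', relation rho I A w U r' /\ {in new_points A r', forall i, i \notin D}.
Proof.
move=> inf Ust gw [fr mr Ur]; have [uA AI fw] := gw.
have [t [ft tD]] := perm_move (I ++ A) (new_points A r) D inf.
have [fI fA] := (fixes_cat I A t).1 ft.
exists [seq (act t p.1, perm_mul t p.2) | p <- r]; split; first split.
- by move=> _ /mapP[p /fr fp ->]; apply: fixes_mul.
- move=> _ /mapP[p pr ->] /=; have [i iA iA'] := moves_outside uA (mr _ pr).
  apply/negP => /perm_mem e; have := e (pfun t (pfun p.2 i)).
  rewrite (map_f (pfun (perm_mul t p.2)) iA) => /esym tA; move/negP: iA'; apply.
  by rewrite -(pfun_inj (fA _ tA)).
- rewrite -(comb_rho Hrho) -{1}(set_generator_fixed gw ft) -(rhoD Hrho).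
  by have [_ _ Us] := Ust; apply: Us.
move=> i /new_pointsP[_ [/mapP[p pr ->] /mapP[j jA ->] iA]].
have jA' : pfun p.2 j \notin A by apply: contraNN iA => h; rewrite /= fA.
apply: tD; first by apply/new_pointsP; exists p; rewrite map_f.
rewrite mem_cat negb_or jA' andbT; apply: contraNN (AI _ jA) => jI.
by rewrite -(pfun_inj (fr _ pr _ jI)).
Qed.

End Separation.

Section Separate.

Variables (Psi : eqType) (L : fieldType) (act : perm_of Psi -> {rmorphism L -> L}).
Variable var : Psi -> L.
Hypothesis gf : generic_gfield act var.
Variables (V : lmodType L) (rho : perm_of Psi -> V -> V).
Hypothesis Hrho : semirep (fun s => act s) rho.
Implicit Types (I A B J S : seq Psi) (s g h : perm_of Psi).
Implicit Types (r : seq (L * perm_of Psi)) (U : V -> Prop) (H : V -> L -> Prop).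
Implicit Types (us ts ls : seq (seq Psi * V)).

Lemma zero_graph I us : gens_ok rho I us ->
  functional_graph act rho I (fun x y => gspan rho I us x /\ y = 0).
Proof.
move=> gus; have [S0 SP Ss] := gspan_stable rho I us; split.
- by [].
- by move=> a x _ x' _ [Hx ->] [Hx' ->]; split; [apply: SP|rewrite mulr0 addr0].
- by move=> s x _ fs [Hx ->]; split; [apply: Ss|rewrite rmorph0].
- by move=> y [].
- by move=> x y [Hx _]; apply: (gspan_smooth gf Hrho gus).
Qed.

Definition separates I u :=
  exists H, functional_graph act rho I H /\ exists2 y, H u y & y != 0.

(* [ts] carries the generators of maximal support size still to be treated, [ls]
   those of smaller size: treating a generator subject to a relation removes it from
   [ts], at the cost of finitely many new members of [ls]. *)
Lemma separates_step n : n = 0%N \/ infinite_index Psi ->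
  (forall ls I u, gens_ok rho I ls -> {in ls, forall p, (size p.1 < n)%N} ->
     gspan rho I ls u -> u != 0 -> separates I u) ->
  forall ts ls I u, gens_ok rho I (ts ++ ls) -> {in ts, forall p, (size p.1 <= n)%N} ->
  {in ls, forall p, (size p.1 < n)%N} ->
  gspan rho I (ts ++ ls) u -> u != 0 -> separates I u.
Proof.
move=> ninf base; elim=> [|[A w] ts IH] ls I u gus tsn lsn Hu u0; first exact: (base ls).
have gw : set_generator rho I A w by apply: (gus (A, w)); rewrite mem_head.
have gus' : gens_ok rho I (ts ++ ls).
  by move=> p ptl; apply: gus; rewrite cat_cons inE ptl orbT.
have tsn' : {in ts, forall p, (size p.1 <= n)%N}.
  by move=> p pts; apply: tsn; rewrite inE pts orbT.
have sA : (size A <= n)%N by apply: (tsn (A, w)); rewrite mem_head.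
have [Hu'|Hu'] := pselect (gspan rho I (ts ++ ls) u); first exact: (IH ls).
have [u' [r [Hu'' fr uE]]] := gspan_cons Hrho Hu; rewrite /= in uE.
have Ust := gspan_stable rho I (ts ++ ls).
have [[r0 rel0]|norel] :=
    pselect (exists r, relation rho I A w (gspan rho I (ts ++ ls)) r); last first.
  (* Without a relation, the zero functional on the remaining span extends by sending [w] to a [q]
     that detects the combination occurring in [u]. *)
  have c0 : comb rho r w != 0.
    by apply: contra_notN Hu' => /eqP c0; rewrite uE c0 addr0.
  have Ainf : A = [::] \/ infinite_index Psi.
    by case: ninf => [n0|]; [left; move: sA; rewrite n0 leqn0 => /nilP|right].
  have [q fq q0] := comb_detect gf Hrho Ainf gw fr c0.
  have [r' [fr' mr' [y [Hy _]]]|H' [H'g HH' H'w]] :=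
      functional_adjoin gf Hrho (zero_graph gus') gw fq.
    by apply: norel; exists r'.
  exists H'; split=> //; exists (\sum_(p <- r) p.1 * act p.2 q) => //.
  have [_ HP _ _ _] := H'g.
  have := HP 1 _ _ _ _ (HH' u' 0 (conj Hu'' erefl)) (functional_graph_comb H'g H'w fr).
  by rewrite scale1r mulr0 add0r -uE.
case: ninf => [n0|inf].
  (* For [n = 0] the support is empty, the relation has no terms, and [w] was redundant after
     all. *)
  exfalso; apply: Hu'; rewrite uE; apply: (stable_subD Ust) => //.
  apply: (comb_stable Ust fr).
  have [fr0 mr0 wU] := rel0; case: r0 fr0 mr0 wU {rel0} => [|p r0] _ mr0.
    by rewrite /comb big_nil addr0.
  by move: sA (mr0 p (mem_head _ _)); rewrite n0 leqn0 /moves => /nilP->.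
(* The new points are made to avoid a support [S] of [u], for the final averaging, and the supports
   of the other generators, for refinement to [J]. *)
have [S fS] := gspan_smooth gf Hrho gus Hu.
have [r' [[fr' mr' wU] r'D]] := relation_move Hrho
  (S ++ flatten [seq p.1 | p <- ts ++ ls]) inf Ust gw rel0.
have [uA AI fw] := gw.
pose B := new_points A r'; pose J := B ++ I.
have IJ : {subset I <= J} by apply: sub_cat_r.
have BJ : {subset B <= J} by move=> i iB; rewrite mem_cat iB.
have usJ : {in ts ++ ls, forall p, {in p.1, forall i, i \notin J}}.
  move=> p pus i ip; rewrite mem_cat negb_or; have [_ pI _] := gus' _ pus.
  rewrite pI // andbT; apply/negP => /r'D; rewrite mem_cat negb_or => /andP[_].
  move/negP; apply; apply/flattenP; exists p.1 => //.
  by apply: (map_f (fun p : seq Psi * V => p.1)).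
have AJ : {in A, forall i, i \notin J}.
  move=> i iA; rewrite mem_cat negb_or AI // andbT.
  by apply/new_pointsP => -[p [_ _]]; rewrite iA.
have usJA : {in (A, w) :: ts ++ ls, forall p, {in p.1, forall i, i \notin J}}.
  by move=> p; rewrite inE => /predU1P[->|/usJ].
have [new1 [g1 s1 wJ]] := gspan_refine Hrho gus' IJ usJ wU.
have [new2 [g2 s2 uJ]] := gspan_refine Hrho gus IJ usJA Hu.
pose new3 := [seq ([seq i <- map (pfun p.2) A | i \notin J], rho p.2 w) | p <- r'].
have g3 : gens_ok rho J new3.
  by move=> _ /mapP[p pr ->]; apply: (gen_translate Hrho gw IJ); apply: fr'.
have s3 : {in new3, forall p, (size p.1 < n)%N}.
  move=> _ /mapP[p pr ->] /=; apply: leq_trans sA.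
  by apply: (size_new_gen uA pr (mr' _ pr)).
have lt_all : {in ts ++ ls, forall p, (size p.1 <= n)%N}.
  by move=> p; rewrite mem_cat => /orP[/tsn'|/lsn/ltnW].
pose ls' := ls ++ new1 ++ new2 ++ new3.
have wspan : gspan rho J (ts ++ ls') w.
  rewrite -(addrK (comb rho r' w) w).
  apply: (stable_subB (gspan_stable rho J (ts ++ ls'))).
    apply: gspan_sub wJ => p; rewrite /ls' !mem_cat -orbA.
    by case/or3P=> ->; rewrite ?orbT.
  apply: (stable_sub_sum (gspan_stable rho J (ts ++ ls'))) => p pr _.
  apply: (stable_subZ _ (gspan_stable rho J (ts ++ ls'))).
  apply: (gspan_gen (p := ([seq i <- map (pfun p.2) A | i \notin J], rho p.2 w))).
  by rewrite /ls' !mem_cat (map_f _ pr) !orbT.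
have [|||H [Hg [y Huy y0]]] := IH ls' J u _ tsn' _ _ u0.
- move=> p; rewrite /ls' catA !mem_cat => /orP[ptl|/or3P[/g1|/g2|/g3]] //.
  have ptl' : p \in ts ++ ls by rewrite mem_cat.
  by apply: set_generator_sub (gus' _ ptl') IJ (usJ _ ptl').
- move=> p; rewrite /ls' !mem_cat => /or4P[/lsn|/s1[q /lt_all]|/s2[q qus]|/s3] //.
    by move=> qn pq; apply: leq_trans qn.
  move=> pq; apply: leq_trans pq _; move: qus; rewrite inE => /predU1P[->//|].
  exact: lt_all.
- apply: gspan_trans uJ => p; rewrite inE => /predU1P[->//|pin].
  apply: gspan_gen; move: pin; rewrite /ls' !mem_cat -orbA.
  by case/or3P=> ->; rewrite ?orbT.
apply: (functional_average_nonzero gf Hrho inf Hg Huy y0 (A := S)).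
  by move=> s /fixes_cat[_]; apply: fS.
by move=> b /r'D; rewrite mem_cat negb_or => /andP[].
Qed.

(** Outer induction on the support size. At size 0 no smaller generators exist, so their span is
    zero. *)
Lemma generators_separate n ts I u : n = 0%N \/ infinite_index Psi ->
  gens_ok rho I ts -> {in ts, forall p, (size p.1 <= n)%N} ->
  gspan rho I ts u -> u != 0 -> separates I u.
Proof.
elim: n ts I u => [|n IH] ts I u ninf gts tsn Hu u0;
  apply: (@separates_step _ ninf _ ts [::] I u) => //; rewrite ?cats0 //.
- case=> [|p ls] J v _ lsn Hv v0; last by have := lsn p (mem_head _ _).
  move/eqP: v0; case; pattern v; apply: Hv => //; split=> // [a x y -> ->|s x _ ->].
    by rewrite scaler0 addr0.
  by rewrite (rho0 Hrho).
- move=> ls J v gls lsn Hv v0; apply: (IH ls) => //.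
  by case: ninf => //; right.
Qed.

(** * Galois descent and passage to all smooth vectors *)

Lemma permutation_extension S (t : seq Psi) : uniq S -> t \in permutations S ->
  exists g, map (pfun g) S = t.
Proof.
move=> uS; rewrite mem_permutations => tS; have ut : uniq t by rewrite (perm_uniq tS).
case: S uS tS => [|x0 S'] uS tS.
  by exists (perm_one Psi); move: tS => /perm_nilP->.
set S := x0 :: S' in uS tS *; have sz : size t = size S := perm_size tS.
have [|g fg] := @perm_extension Psi S (fun i => nth x0 t (index i S)).
  move=> i j iS jS /eqP; rewrite nth_uniq ?sz ?index_mem // => /eqP e.
  by rewrite -(nth_index x0 iS) e nth_index.
exists g; apply: (@eq_from_nth _ x0); rewrite size_map // => i iS.
by rewrite (nth_map x0) // fg ?mem_nth // index_uniq.
Qed.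

(* Galois descent for the symmetric group of [S]: the [p.2] are traces of multiples
   [c v], and [dedekind_dual] recovers [v] from them. *)
Lemma speiser S v : uniq S -> (forall s, fixes_pointwise S s -> rho s v = v) ->
  exists ws : seq (L * V), v = \sum_(p <- ws) p.1 *: p.2 /\
   {in ws, forall p, (forall s, preserves S s -> rho s p.2 = p.2) /\
                     gspan rho [::] [:: (S, v)] p.2}.
Proof.
move=> uS fv.
(* A chosen permutation of [Psi] carrying the list [S] to its reordering [t]; the identity is only a
   default for other lists. *)
pose gt (t : seq Psi) := if pselect (exists g, map (pfun g) S = t) is left e
             then projT1 (cid e) else perm_one Psi.
have gtE (t : seq Psi) : t \in permutations S -> map (pfun (gt t)) S = t.
  move=> /(permutation_extension uS) e; rewrite /gt; case: pselect => // e'.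
  by case: cid.
pose D c := forall s, fixes_pointwise S s -> act s c = c.
have SS : S \in permutations S by rewrite mem_permutations.
have [| |t|ds [dsD ds1 ds0]] := @dedekind_dual L D _ (fun t => act (gt t)) S
    [seq t <- permutations S | t != S].
- by move=> s _; rewrite rmorph1.
- by move=> a b Da Db s fs; rewrite rmorphM /= Da ?Db.
- rewrite mem_filter => /andP[tS tp].
  have [i iS ti] : exists2 i, i \in S & pfun (gt t) i != i.
    apply: contrapT => no; move/eqP: tS; apply; rewrite -(gtE t tp).
    by apply: map_id_in => i iS; apply/eqP/negPn/negP => h; apply: no; exists i.
  exists (var i); first by move=> s fs; rewrite (gf_var gf) fs.
  rewrite !(gf_var gf); apply: contra_neq ti => /(gf_inj gf) ->.
  have /eq_in_map -> // : map (pfun (gt S)) S = map id S by rewrite gtE ?map_id.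
(* Trace of [c *: v] over the symmetric group of [S]; for [c] in [D] the choice of lifts [gt] does
   not matter. *)
pose w c := \sum_(t <- permutations S) rho (gt t) (c *: v).
exists [seq (d.1, w d.2) | d <- ds]; split.
  rewrite big_map /w.
  under eq_bigr do rewrite scaler_sumr.
  rewrite exchange_big /=.
  under eq_bigr => t _ do under eq_bigr do rewrite (rhoZ Hrho) scalerA.
  under eq_bigr do rewrite -scaler_suml.
  rewrite (perm_big _ (perm_to_rem SS)) big_cons /= ds1 scale1r fv; last first.
    by move=> i iS; have /eq_in_map -> : map (pfun (gt S)) S = map id S by rewrite gtE ?map_id.
  rewrite big_seq big1 ?addr0 // => t; rewrite mem_rem_uniq ?permutations_uniq //.
  rewrite inE => /andP[tS tp]; rewrite ds0 ?scale0r // mem_filter.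
  by move: tS => /= ->.
move=> _ /mapP[d dds ->] /=; split; last first.
  apply: (stable_sub_sum (gspan_stable rho [::] _)) => t _ _.
  have [_ _ Us] := gspan_stable rho [::] [:: (S, v)]; apply: Us => //.
  apply: (stable_subZ _ (gspan_stable rho [::] _)).
  by apply: (@gspan_gen _ _ _ _ [::] _ (S, v)); rewrite mem_head.
move=> s ps; rewrite /w (rho_sum Hrho).
have fc g : fixes_pointwise S g -> rho g (d.2 *: v) = d.2 *: v.
  by move=> fg; rewrite (rhoZ Hrho) fv // dsD.
have e g g' : map (pfun g) S = map (pfun g') S -> rho g (d.2 *: v) = rho g' (d.2 *: v).
  move=> /eq_in_map gg'; rewrite -[g](perm_mulVK g') (rhoM Hrho) fc //.
  by move=> i iS; rewrite !perm_mulE gg' //= pfunK.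
(* A permutation preserving [S] permutes its reorderings, and therefore the terms of the trace. *)
have bij : perm_eq [seq map (pfun s) t | t <- permutations S] (permutations S).
  have inj : injective (map (pfun s)) by apply/inj_map/pfun_inj.
  have u1 : uniq [seq map (pfun s) t | t <- permutations S].
    by rewrite map_inj_uniq // permutations_uniq.
  have sub : {subset [seq map (pfun s) t | t <- permutations S] <= permutations S}.
    move=> _ /mapP[t tS ->]; move: tS; rewrite !mem_permutations => tS.
    apply: perm_trans (perm_map _ tS) _.
    have us : uniq (map (pfun s) S) by rewrite map_inj_uniq //; exact: pfun_inj.
    apply: uniq_perm => //.
    have sub : {subset map (pfun s) S <= S} by move=> _ /mapP[i iS ->]; apply: ps.
    by have [|_ ee] := uniq_min_size us sub; rewrite ?size_map.
  apply: uniq_perm => //; first exact: permutations_uniq.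
  by have [|_ ee] := uniq_min_size u1 sub; rewrite ?size_map.
rewrite -[RHS](perm_big _ bij) big_map big_seq [RHS]big_seq; apply: eq_bigr => t tS.
rewrite -(rhoM Hrho); apply: e; rewrite gtE.
  by rewrite -[in RHS](gtE t tS) -map_comp.
by rewrite -(perm_mem bij) map_f.
Qed.

(** For infinite [Psi], [A] is a support of [v]. For finite [Psi], descent over all of [Psi] gives
    vectors fixed by the whole group, for which the empty support suffices. *)
Lemma smooth_decompose v : smooth_vec rho v -> exists A (ws : seq (L * V)),
  [/\ A = [::] \/ infinite_index Psi, v = \sum_(p <- ws) p.1 *: p.2 &
  {in ws, forall p, set_generator rho [::] A p.2 /\ gspan rho [::] [:: (A, v)] p.2}].
Proof.
move=> [S0 fS0]; have [inf|fin] := pselect (infinite_index Psi).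
  have [|ws [vE wsP]] := @speiser (undup S0) v (undup_uniq _).
    by move=> s fs; apply: fS0; apply: fixes_sub fs => i; rewrite mem_undup.
  exists (undup S0), ws; split=> //; first by right.
  by move=> p /wsP[fp sp]; split=> //; split=> [|//|s _ ps]; [exact: undup_uniq|exact: fp].
have [X allX] : exists X : seq Psi, forall i : Psi, i \in X.
  move: fin => /existsNP[X noX]; exists X => i.
  by apply: contrapT => /negP iX; apply: noX; exists i.
have [|ws [vE wsP]] := @speiser (undup X) v (undup_uniq _).
  by move=> s fs; apply: fS0 => i _; apply: fs; rewrite mem_undup.
exists [::], ws; split=> //; first by left.
move=> p /wsP[fp sp]; split.
  by split=> // s _ _; apply: fp => i _; rewrite mem_undup.
move=> U Ust Uv; apply: sp => // q; rewrite inE => /eqP->.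
by apply: (Uv ([::], v)); rewrite mem_head.
Qed.

Lemma functional_extend_smooth H v : functional_graph act rho [::] H ->
  smooth_vec rho v ->
  exists H', [/\ functional_graph act rho [::] H', gsub H H' & gdom H' v].
Proof.
move=> Hg /smooth_decompose[A [ws [Ainf vE wsP]]].
suff [H' [H'g HH' H'd]] : exists H', [/\ functional_graph act rho [::] H', gsub H H' &
    {in ws, forall p, gdom H' p.2}].
  exists H'; split=> //; rewrite vE; apply: (stable_sub_sum (gdom_stable H'g)) => p pws _.
  by apply: (stable_subZ _ (gdom_stable H'g)); apply: H'd.
elim: {vE}ws wsP => [|p ws IH] wsP; first by exists H; split.
have [q qws|H1 [H1g HH1 H1d]] := IH; first by apply: wsP; rewrite inE qws orbT.
have [gp _] := wsP p (mem_head _ _).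
have [|H2 [H2g H12 H2d]] := functional_extend_gen gf Hrho (leqnn (size A)) _ H1g gp.
  by case: Ainf => [->|]; [left|right].
exists H2; split=> // [x y /HH1/H12//|q]; rewrite inE => /predU1P[->//|/H1d[y /H12 Hy]].
by exists y.
Qed.

Lemma functional_total H0 : functional_graph act rho [::] H0 ->
  exists H, [/\ functional_graph act rho [::] H, gsub H0 H &
    forall v, smooth_vec rho v -> gdom H v].
Proof.
move=> H0g; pose P (X : set (V * L)) := functional_graph act rho [::] (fun x y => X (x, y)).
have [|||X [PX H0X Xmax]] := @Zorn_above _ P (fun p => H0 p.1 p.2) (0, 0).
- exact: H0g.
- by case: H0g.
- move=> C X0 CX0 CP Ctot.
  have join p q : (\bigcup_(X in C) X)%classic p -> (\bigcup_(X in C) X)%classic q ->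
      exists X, [/\ C X, X p & X q].
    move=> [X CX Xp] [Y CY Yq]; have [XY|YX] := Ctot _ _ CX CY.
      by exists Y; split=> //; apply: XY.
    by exists X; split=> //; apply: YX.
  split.
  + by exists X0 => //; have [+ _ _ _ _] := CP _ CX0.
  + move=> a x y x' y' Hx Hx'; have [X [CX Xx Xx']] := join _ _ Hx Hx'.
    by exists X => //; have [_ + _ _ _] := CP _ CX; apply.
  + by move=> s x y fs [X CX Xx]; exists X => //; have [_ _ + _ _] := CP _ CX; apply.
  + by move=> y [X CX Xx]; have [_ _ _ + _] := CP _ CX; apply.
  + by move=> x y [X CX Xx]; have [_ _ _ _] := CP _ CX; apply; exact: Xx.
exists (fun x y => X (x, y)); split=> // [x y|v smv].
  exact: (H0X (x, y)).
have [H' [H'g XH' [y H'v]]] := functional_extend_smooth PX smv.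
exists y; rewrite -(Xmax (fun p => H' p.1 p.2)) //.
by move=> [a b]; apply: XH'.
Qed.

(** A nonzero component of [v] is separated first and the functional extended. Its kernel is stable,
    so if it contained [v] it would contain that component, which lies in the span of [v]. *)
Lemma functional_nonzero v : smooth_vec rho v -> v != 0 ->
  exists H, [/\ functional_graph act rho [::] H,
    forall x, smooth_vec rho x -> gdom H x & exists2 y, H v y & y != 0].
Proof.
move=> smv v0; have [A [ws [Ainf vE wsP]]] := smooth_decompose smv.
have [p pws p0] : exists2 p, p \in ws & p.2 != 0.
  apply: contrapT => no; move/eqP: v0; apply; rewrite vE big_seq big1 // => p pws.
  apply/eqP/negPn/negP => h; apply: no; exists p => //.
  by apply: contraNneq h => ->; rewrite scaler0.
have [gp sp] := wsP p pws.
have [|q|q||//|H1 [H1g [y H1p y0]]] :=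
    @generators_separate (size A) [:: (A, p.2)] [::] p.2.
- by case: Ainf => [->|]; [left|right].
- by rewrite inE => /eqP->.
- by rewrite inE => /eqP->.
- by apply: (@gspan_gen _ _ _ _ [::] _ (A, p.2)); rewrite mem_head.
have [H [Hg H1H Hd]] := functional_total H1g.
exists H; split=> //; have [z Hz] := Hd _ smv; exists z => //.
apply: contraNneq y0 => z0; rewrite z0 in Hz.
have Hp0 : H p.2 0.
  pattern p.2; apply: sp => [|q]; last by rewrite inE => /eqP->.
  have [H00 HP Hs _ _] := Hg; split=> // [a x x' Hx Hx'|s x fs Hx].
    by have := HP a _ _ _ _ Hx Hx'; rewrite mulr0 addr0.
  by have := Hs _ _ _ fs Hx; rewrite rmorph0.
by rewrite (functional_graph_fun Hg (H1H _ _ H1p) Hp0).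
Qed.

End Separate.

(** * Tensor fields and extension of scalars *)

Section TensorField.

Variables (Psi : eqType) (F : fieldType) (k : divringClosed F).
Variables (L : fieldType) (kappa : F -> L) (iota : Psi -> {rmorphism F -> L}).
Hypothesis HL : is_frac_restricted_tensor k kappa iota.
Variable act : perm_of Psi -> {rmorphism L -> L}.
Hypothesis Hact : is_perm_action k kappa iota act.

Lemma frac_tensor_gen (A : L -> Prop) : subfield_prop A ->
  (forall c, c \in k -> A (kappa c)) -> (forall i y, A (iota i y)) -> forall z, A z.
Proof.
move=> sA Ak Ai z; have [_ [_ _ _ _ /(_ z)[a [b [ta tb _ ->]]]]] := HL.
have [A1 _ AM AV] := sA.
suff tA c : in_tensor k kappa iota c -> A c by apply: (AM) => //; [|apply: AV]; apply: tA.
move=> [s [sk ->]]; rewrite big_seq.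
elim/big_ind: _ => [|x y|p ps]; [exact: subfield0|exact: subfieldD|].
apply: (AM); first exact/Ak/sk.
by elim/big_ind: _ => [//|x y Ax Ay|q _]; [apply: (AM)|apply: Ai].
Qed.

Lemma frac_tensor_ext (f g : {rmorphism L -> L}) :
  (forall c, c \in k -> f (kappa c) = g (kappa c)) ->
  (forall i y, f (iota i y) = g (iota i y)) -> f =1 g.
Proof.
apply: frac_tensor_gen; split.
- by rewrite !rmorph1.
- by move=> y z fy fz; rewrite !rmorphB fy fz.
- by move=> y z fy fz; rewrite !rmorphM /= fy fz.
- by move=> y fy; rewrite !fmorphV fy.
Qed.

Lemma kappa0 : kappa 0 = 0.
Proof.
have [_ [kD _ _ _ _]] := HL; apply: (addIr (kappa 0)).
by rewrite -kD ?rpred0 // !add0r.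
Qed.

Lemma kappaN1 : kappa (-1) = -1.
Proof.
have [k1 [kD _ _ _ _]] := HL; apply/eqP; rewrite -addr_eq0 -k1 -kD ?rpredN ?rpred1 //.
by rewrite addNr kappa0.
Qed.

Lemma iota_var_inj (x : F) : x \notin k -> injective (fun i => iota i x).
Proof.
move=> xk i j eij; apply/eqP/negPn/negP => ij.
have [k1 [_ _ _ indep _]] := HL.
have ind1 : k_indep k id [:: 1; x].
  move=> [|c0 [|c1 [|]]] //= _ ck; rewrite !big_ord_recr big_ord0 /= add0r mulr1.
  have c0k : c0 \in k by apply: ck; rewrite mem_head.
  have c1k : c1 \in k by apply: ck; rewrite !inE eqxx orbT.
  have [->|c10] := eqVneq c1 0.
    by rewrite mul0r addr0 => -> c; rewrite !inE orbb => /eqP.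
  move=> /eqP; rewrite addrC addr_eq0 => /eqP e; case/negP: xk.
  by rewrite -[x](mulKf c10) e rpredM ?rpredV ?rpredN.
have uij : uniq [:: i; j] by rewrite /= inE ij.
have allind s : s \in [:: [:: 1; x]; [:: 1; x]] -> k_indep k id s.
  by rewrite !inE orbb => /eqP->.
(* The coefficients follow the order of [choices]: they select the difference of [1 (x) x] and
   [x (x) 1], which would be 0. *)
have := indep _ [:: [:: 1; x]; [:: 1; x]] uij erefl allind [:: 0; 1; -1; 0] erefl.
have csk c : c \in [:: 0; 1; -1; 0] -> c \in k.
  by rewrite !inE => /or4P[] /eqP->; rewrite ?rpredN ?rpred0 ?rpred1.
move=> /(_ csk) /=; rewrite !big_ord_recr big_ord0 /= !big_cons !big_nil /=.
rewrite kappa0 kappaN1 k1 !rmorph1 !mul0r !mulr1 !mul1r !add0r !addr0 mulN1r eij subrr.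
by move=> /(_ erefl 1); rewrite !inE eqxx orbT => /(_ isT)/eqP; rewrite oner_eq0.
Qed.

(** Action laws, smoothness and generation are checked on generators; [iota i y] is fixed by the
    stabiliser of [b] if [i = b], and does not involve [b] otherwise. *)
Lemma frac_tensor_gfield (x : F) : x \notin k -> generic_gfield act (fun i => iota i x).
Proof.
have [actk acti] := Hact; move=> xk; split.
- move=> s t; apply: (@frac_tensor_ext (act (perm_mul s t)) (act s \o act t)) => [c ck|i y] /=.
    by rewrite !actk.
  by rewrite !acti.
- apply: (@frac_tensor_ext (act (perm_one Psi)) idfun) => [c ck|i y] /=.
    by rewrite actk.
  by rewrite acti.
- have two u v w : (forall s, act s u = u -> act s v = v -> act s w = w) ->
      (exists S, forall s, fixes_pointwise S s -> act s u = u) ->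
      (exists S, forall s, fixes_pointwise S s -> act s v = v) ->
      exists S, forall s, fixes_pointwise S s -> act s w = w.
    move=> uvw [S fS] [T fT]; exists (S ++ T) => s /fixes_cat[/fS su /fT sv].
    exact: uvw.
  apply: frac_tensor_gen => [|c ck|i y]; first split.
  + by exists [::] => s _; rewrite rmorph1.
  + by move=> u v; apply: two => s su sv; rewrite rmorphB su sv.
  + by move=> u v; apply: two => s su sv; rewrite rmorphM /= su sv.
  + by move=> u Hu; apply: (two u u) => // s su _; rewrite fmorphV su.
  + by exists [::] => s _; rewrite actk.
  + by exists [:: i] => s fs; rewrite acti fs ?mem_head.
- by move=> s i; rewrite acti.
- exact: iota_var_inj.
- move=> b A sA AE Ab; apply: frac_tensor_gen => // [c ck|i y].
    by apply: Ab => s _; rewrite actk.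
  have [->|ib] := eqVneq i b.
    by apply: Ab => s fs; rewrite acti fs ?mem_head.
  apply: AE; exists [:: i]; rewrite inE eq_sym ib; split=> // s fs.
  by rewrite acti fs ?mem_head.
Qed.

End TensorField.

Lemma linear_extension (K L : fieldType) (phi : {rmorphism K -> L}) (N : lmodType K)
  (H0 : N -> L -> Prop) :
  H0 0 0 -> (forall a x y x' y', H0 x y -> H0 x' y' -> H0 (a *: x + x') (phi a * y + y')) ->
  (forall y, H0 0 y -> y = 0) ->
  exists f : N -> L, [/\ forall x y, f (x + y) = f x + f y,
    forall a x, f (a *: x) = phi a * f x & forall x y, H0 x y -> f x = y].
Proof.
move=> H00 H0P H01.
pose P (X : set (N * L)) := [/\ X (0, 0), forall a x y x' y', X (x, y) -> X (x', y') ->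
  X (a *: x + x', phi a * y + y') & forall y, X (0, y) -> y = 0].
have [|||X [[X0 XP X1] H0X Xmax]] := @Zorn_above _ P (fun p => H0 p.1 p.2) (0, 0).
- by [].
- by [].
- move=> C Z0 CZ0 CP Ctot; split.
  + by exists Z0 => //; have [] := CP _ CZ0.
  + move=> a x y x' y' [Z CZ Zx] [Y CY Yx']; have [ZY|YZ] := Ctot _ _ CZ CY.
      by exists Y => //; have [_ + _] := CP _ CY; apply=> //; apply: ZY.
    by exists Z => //; have [_ + _] := CP _ CZ; apply=> //; apply: YZ.
  + by move=> y [Z CZ Zy]; have [_ _] := CP _ CZ; apply.
have Xfun x y y' : X (x, y) -> X (x, y') -> y = y'.
  move=> Xy Xy'; have := XP (-1) _ _ _ _ Xy Xy'.
  rewrite scaleN1r addNr rmorphN rmorph1 mulN1r => /X1/eqP.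
  by rewrite addrC subr_eq0 => /eqP.
have dom v : exists y, X (v, y).
  apply: contrapT => nv.
  (* The graph obtained by adjoining [v] with value 0. *)
  pose Y : set (N * L) := fun p => exists a x, X (x, p.2) /\ p.1 = a *: v + x.
  have XY : (X `<=` Y)%classic.
    by move=> [x y] Xx; exists 0, x; rewrite /= scale0r add0r.
  have YX : Y = X.
    apply: Xmax => //; split; first exact: XY.
      move=> b _ y _ y' [a [x [/= Xx ->]]] [a' [x' [/= Xx' ->]]].
      exists (b * a + a'), (b *: x + x'); split; first exact: XP.
      by rewrite /= scalerDr scalerA scalerDl addrACA.
    move=> y [a [x [/= Xx /esym/eqP]]]; rewrite addrC addr_eq0 => /eqP xE.
    have [a0|a0] := eqVneq a 0; first by apply: X1; rewrite xE a0 scale0r oppr0 in Xx.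
    exfalso; apply: nv; exists (phi (- a^-1) * y + 0).
    have := XP (- a^-1) _ _ _ _ Xx X0.
    by rewrite xE addr0 scaleNr scalerN opprK scalerA mulVf // scale1r.
  apply: nv; exists 0; rewrite -YX; exists 1, 0.
  by rewrite /= scale1r addr0.
pose f x := projT1 (cid (dom x)).
have fX x : X (x, f x) by rewrite /f; case: cid.
exists f; split.
- move=> x y; apply: Xfun (fX _) _.
  by have := XP 1 _ _ _ _ (fX x) (fX y); rewrite scale1r rmorph1 mul1r.
- move=> a x; apply: Xfun (fX _) _.
  by have := XP a _ _ _ _ (fX x) X0; rewrite !addr0.
- by move=> x y Hxy; apply: Xfun (fX _) _; apply: (H0X (x, y)).
Qed.

(** * Extension of scalars from [K] to [L] through the linear dual *)

Section ScalarExtension.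

Variables (Psi : eqType) (L : fieldType) (act : perm_of Psi -> {rmorphism L -> L}).
Variable var : Psi -> L.
Hypothesis gf : generic_gfield act var.
Variables (K : fieldType) (phi : {rmorphism K -> L}) (actK : perm_of Psi -> K -> K).
Hypothesis HK : forall s a, phi (actK s a) = act s (phi a).
Variables (N : lmodType K) (rho : perm_of Psi -> N -> N).
Hypothesis Hrho : smooth_semirep actK rho.

Definition klinear (f : N -> L) :=
  (forall x y, f (x + y) = f x + f y) /\ (forall a x, f (a *: x) = phi a * f x).

Definition kdual := {f : N -> L | klinear f}.

Lemma twist_klinear s (f : kdual) :
  klinear (fun x => act (perm_inv s) (sval f (rho s x))).
Proof.
case: f => f [fD fZ]; have [[rD rZ _ _] _] := Hrho; split=> [x y|a x] /=.
  by rewrite rD fD rmorphD.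
by rewrite rZ fZ rmorphM /= HK (actVK gf).
Qed.

(** A right action on the dual, which makes [dual_rep] a left action. *)
Definition twist s (f : kdual) : kdual := exist _ _ (twist_klinear s f).

(* [L^o]-valued functions on the [K]-linear dual serve as a substitute for the
   bidual of [L (x)_K N], into which the latter embeds. *)
Definition dual_rep s (T : kdual -> L^o) : kdual -> L^o := fun f => act s (T (twist s f)).

Definition eval_dual (x : N) : kdual -> L^o := fun f => sval f x.

Lemma kdual_ext (f g : kdual) : sval f =1 sval g -> f = g.
Proof.
case: f g => f Hf [g Hg] /= /funext fg; rewrite -{}fg in Hg *.
by congr exist; exact: Prop_irrelevance.
Qed.

Lemma dual_semirep : semirep (fun s => act s) dual_rep.
Proof.
have [[_ _ r1 rM] _] := Hrho; split.
- by move=> s T T'; apply/funext => f; apply: rmorphD.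
- by move=> s a T; apply/funext => f; apply: rmorphM.
- move=> T; apply/funext => f; rewrite /dual_rep (gf_one gf); congr (T _).
  apply: kdual_ext => x /=; rewrite r1.
  have -> : perm_inv (perm_one Psi) = perm_one Psi by apply: perm_ext.
  by rewrite (gf_one gf).
- move=> s t T; apply/funext => f; rewrite /dual_rep (gf_mul gf); congr (act _ (act _ (T _))).
  apply: kdual_ext => x /=; by rewrite rM -(gf_mul gf).
Qed.

Lemma eval_dual_rho s x : dual_rep s (eval_dual x) = eval_dual (rho s x).
Proof. by apply/funext => f; rewrite /dual_rep /eval_dual /= (actKV gf). Qed.

Lemma eval_dualP a x y : eval_dual (a *: x + y) = phi a *: eval_dual x + eval_dual y.
Proof. by apply/funext => -[f [fD fZ]]; rewrite /eval_dual /= fD fZ. Qed.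

Lemma eval_dual_smooth x : smooth_vec dual_rep (eval_dual x).
Proof.
have [_ /(_ x)[S fS]] := Hrho; exists S => s fs.
by rewrite eval_dual_rho fS.
Qed.

Lemma functional_morphism H : functional_graph act dual_rep [::] H ->
  (forall v, smooth_vec dual_rep v -> gdom H v) ->
  exists g : N -> L, rep_morph_to phi (fun s => act s) rho g /\
    forall x, H (eval_dual x) (g x).
Proof.
move=> Hg Hd; pose g x := projT1 (cid (Hd _ (eval_dual_smooth x))).
have gH x : H (eval_dual x) (g x) by rewrite /g; case: cid.
have [H0 HP Hs _ _] := Hg.
have ev0 : eval_dual 0 = 0.
  apply/funext => -[f [fD fZ]]; rewrite /eval_dual /=.
  by rewrite -(scale0r (0 : N)) fZ rmorph0 mul0r.
exists g; split=> //; split.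
- move=> x y; apply: (functional_graph_fun Hg (gH _)).
  have := HP 1 _ _ _ _ (gH x) (gH y).
  by rewrite mul1r -[1](rmorph1 phi) -eval_dualP scale1r.
- move=> a x; apply: (functional_graph_fun Hg (gH _)).
  have := HP (phi a) _ _ _ _ (gH x) (gH 0).
  have -> : g 0 = 0 by apply: (functional_graph_fun Hg (gH _)); rewrite ev0.
  by rewrite addr0 -eval_dualP addr0.
- move=> s x; apply: (functional_graph_fun Hg (gH _)).
  by rewrite -eval_dual_rho; apply: Hs.
Qed.

(** A linear functional with value 1 at [x] shows that [eval_dual x] is nonzero; an equivariant
    functional not killing it is pulled back to [N]. *)
Lemma morphism_nonzero x : x != 0 ->
  exists g : N -> L, rep_morph_to phi (fun s => act s) rho g /\ g x != 0.
Proof.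
move=> x0.
have [|||f [fD fZ fx]] := @linear_extension K L phi N
    (fun z y => exists a, z = a *: x /\ y = phi a).
- by exists 0; rewrite scale0r rmorph0.
- move=> b _ _ _ _ [a [-> ->]] [a' [-> ->]]; exists (b * a + a').
  by rewrite scalerDl scalerA rmorphD rmorphM.
- move=> y [a [/esym/eqP + ->]]; rewrite scaler_eq0 (negPf x0) orbF => /eqP ->.
  by rewrite rmorph0.
have evx : eval_dual x != 0.
  apply/eqP => /(congr1 (fun T : kdual -> L^o => T (exist _ f (conj fD fZ)))).
  rewrite /eval_dual /= (fx x 1); last by exists 1; rewrite scale1r rmorph1.
  by move/eqP; rewrite oner_eq0.
have [H [Hg Hd [y Hy y0]]] := functional_nonzero gf dual_semirep (eval_dual_smooth x) evx.
have [g [gm gH]] := functional_morphism Hg Hd.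
by exists g; split=> //; rewrite (functional_graph_fun Hg (gH x) Hy).
Qed.

(** On the [L]-span of the evaluations at [j m], evaluation at any linear, possibly non-equivariant,
    extension of [f] is well defined. There it depends on [f] alone and is thus equivariant, so it
    extends to all smooth vectors. *)
Lemma morphism_extension (M : lmodType K) (rhoM : perm_of Psi -> M -> M)
  (j : M -> N) (f : M -> L) :
  rep_morph rhoM rho j -> injective j -> rep_morph_to phi (fun s => act s) rhoM f ->
  exists g : N -> L, rep_morph_to phi (fun s => act s) rho g /\ forall x, g (j x) = f x.
Proof.
move=> [jD jZ jr] jinj [fD fZ fr].
have j0 : j 0 = 0 by rewrite -(scale0r 0) jZ scale0r.
have f0 : f 0 = 0 by rewrite -(scale0r 0) fZ rmorph0 mul0r.
have [|||F [FD FZ Fj]] := @linear_extension K L phi N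
    (fun z y => exists m, z = j m /\ y = f m).
- by exists 0.
- move=> b _ _ _ _ [a [-> ->]] [a' [-> ->]]; exists (b *: a + a').
  by rewrite jD jZ fD fZ.
- by move=> y [m [/esym jm ->]]; rewrite -f0; congr f; apply: jinj; rewrite jm j0.
pose F' : kdual := exist _ F (conj FD FZ).
pose cb (l : seq (L * M)) : kdual -> L^o := \sum_(p <- l) p.1 *: eval_dual (j p.2).
have cbF l : cb l F' = \sum_(p <- l) p.1 * f p.2.
  rewrite /cb; elim: l => [|p l IH]; first by rewrite !big_nil.
  rewrite !big_cons -IH; congr (_ * _ + _); rewrite /eval_dual /=.
  by apply: Fj; exists p.2.
pose H0 (T : kdual -> L^o) y := exists l, T = cb l /\ y = T F'.
have H0g : functional_graph act dual_rep [::] H0.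
  split.
  - by exists [::]; rewrite /cb big_nil.
  - move=> a _ _ _ _ [l [-> ->]] [l' [-> ->]].
    exists ([seq (a * p.1, p.2) | p <- l] ++ l'); split=> //.
    rewrite /cb big_cat big_map /= scaler_sumr; congr (_ + _).
    by apply: eq_bigr => p _; rewrite scalerA.
  - move=> s _ _ _ [l [-> ->]]; exists [seq (act s p.1, rhoM s p.2) | p <- l].
    have e : dual_rep s (cb l) = cb [seq (act s p.1, rhoM s p.2) | p <- l].
      rewrite /cb (rho_sum dual_semirep) big_map; apply: eq_bigr => p _ /=.
      by rewrite (rhoZ dual_semirep) eval_dual_rho jr.
    split=> //; rewrite e !cbF big_map rmorph_sum; apply: eq_bigr => p _.
    by rewrite rmorphM /= fr.
  - by move=> y [l [_ ->]].
  - move=> _ _ [l [-> _]]; rewrite /cb; elim: l => [|p l IH].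
      by rewrite big_nil; apply: (smooth_vec0 dual_semirep).
    rewrite big_cons; apply: (smooth_vecP gf dual_semirep) => //.
    exact: eval_dual_smooth.
have [H [Hg H0H Hd]] := functional_total gf dual_semirep H0g.
have [g [gm gH]] := functional_morphism Hg Hd.
exists g; split=> // x; apply: (functional_graph_fun Hg (gH _)); apply: H0H.
exists [:: (1, x)]; rewrite /cb big_seq1 /= scale1r; split=> //.
by rewrite /eval_dual /=; apply/esym/Fj; exists x.
Qed.

End ScalarExtension.

(* Along a composition series, functionals are added one at a time; [v] witnesses that
   a new functional is independent of the previous ones. *)
Lemma finite_length_trivial (Psi : eqType) (L : fieldType)
  (act : perm_of Psi -> {rmorphism L -> L}) (M : lmodType L)
  (rho : perm_of Psi -> M -> M) :
  semirep (fun s => act s) rho ->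
  (forall x, x != 0 -> exists g : M -> L,
     rep_morph_to idfun (fun s => act s) rho g /\ g x != 0) ->
  finite_length rho ->
  exists (n : nat) (f : M -> 'rV[L]_n),
    rep_morph rho (fun s => map_mx (act s)) f /\ bijective f.
Proof.
move=> [rD _ _ _] sep [n [C [Csub C0 Cn Cstep]]].
have morph0 m (f : M -> 'rV[L]_m) : rep_morph rho (fun s => map_mx (act s)) f -> f 0 = 0.
  by move=> [_ fZ _]; rewrite -(scale0r (0 : M)) fZ scale0r.
suff [m [f [fm fsurj finj]]] : exists m (f : M -> 'rV[L]_m),
    [/\ rep_morph rho (fun s => map_mx (act s)) f, forall y, exists x, f x = y &
      forall x, C n x -> f x = 0 -> x = 0].
  exists m, f; split=> //; pose g y := projT1 (cid (fsurj y)).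
  have gK : cancel g f by move=> y; rewrite /g; case: cid.
  exists g => // x; apply/eqP; rewrite -subr_eq0; apply/eqP; apply: finj => //.
  have [fD fZ _] := fm.
  by rewrite fD -scaleN1r fZ gK scaleN1r subrr.
suff: forall j, (j <= n)%N -> exists m (f : M -> 'rV[L]_m),
    [/\ rep_morph rho (fun s => map_mx (act s)) f, forall y, exists x, f x = y &
      forall x, C j x -> f x = 0 -> x = 0] by apply.
elim=> [|j IH] jn.
  exists 0%N, (fun _ => 0); split; first split.
  - by move=> x y; rewrite addr0.
  - by move=> a x; rewrite scaler0.
  - by move=> s x; rewrite map_mx0.
  - by move=> y; exists 0; rewrite [y]thinmx0.
  - by move=> x /C0.
have [m [f [fm fsurj finj]]] := IH (ltnW jn); have [fD fZ fr] := fm.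
have [Csubset _ Cmax] := Cstep j jn.
have [[v [Cv [fv v0]]]|none] := pselect (exists v, C j.+1 v /\ f v = 0 /\ v != 0); last first.
  exists m, f; split=> // x Cx fx; apply/eqP/negPn/negP => x0.
  by apply: none; exists x.
have [g [[gD gZ gr] gv]] := sep v v0.
have g0 : g 0 = 0 by rewrite -(scale0r (0 : M)) gZ /= mul0r.
have f0 := morph0 _ _ fm.
exists (m + 1)%N, (fun x => row_mx (f x) (g x)%:M); split; first split.
- by move=> x y; rewrite add_row_mx -raddfD /= fD gD.
- by move=> a x; rewrite scale_row_mx fZ gZ scale_scalar_mx.
- by move=> s x; rewrite map_row_mx map_scalar_mx fr gr.
- move=> y; have [x fx] := fsurj (lsubmx y).
  (* Since [f v = 0] and [g v] is nonzero, a multiple of [v] corrects the last coordinate only. *)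
  exists (x + ((rsubmx y 0 0 - g x) / g v) *: v).
  rewrite fD fZ fv scaler0 addr0 fx gD gZ /= divfK // addrC subrK.
  by rewrite -mx11_scalar hsubmxK.
- move=> x Cx /eqP; rewrite -[X in _ == X]row_mx0 => /eqP/eq_row_mx[fx].
  move=> /matrixP/(_ 0 0); rewrite !mxE /= mulr1n => gx.
  have [C_0 CD CZ Cr] := Csub j; have [C'_0 C'D C'Z C'r] := Csub j.+1.
  (* [C j] plus the common kernel of [f] and [g] in [C j.+1]. By simplicity of the factor it is one
     of the two terms: the smaller gives [x = 0], the larger would force [g v = 0]. *)
  pose P z := exists c d, [/\ C j c, C j.+1 d, f d = 0, g d = 0 & z = c + d].
  have subP : subrep rho P.
    split.
    + by exists 0, 0; rewrite addr0.
    + move=> _ _ [c [d [Cc Cd fd gd ->]]] [c' [d' [Cc' Cd' fd' gd' ->]]].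
      exists (c + c'), (d + d'); split; [exact: CD|exact: C'D| | |by rewrite addrACA].
        by rewrite fD fd fd' addr0.
      by rewrite gD gd gd' addr0.
    + move=> a _ [c [d [Cc Cd fd gd ->]]].
      exists (a *: c), (a *: d); split; [exact: CZ|exact: C'Z| | |by rewrite scalerDr].
        by rewrite fZ fd scaler0.
      by rewrite gZ gd mulr0.
    + move=> s _ [c [d [Cc Cd fd gd ->]]].
      exists (rho s c), (rho s d); split; [exact: Cr|exact: C'r| | |by rewrite rD].
        by rewrite fr fd map_mx0.
      by rewrite gr gd rmorph0.
  have [z Cz|z [c [d [Cc Cd _ _ ->]]]|PC|CP] := Cmax P subP.
  + by exists z, 0; rewrite addr0 f0 g0; split.
  + by apply: C'D => //; apply: Csubset.
  + by apply: finj => //; apply: PC; exists 0, x; rewrite add0r.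
  + have [c [d [Cc Cd fd gd vE]]] := CP v Cv.
    have c0 : c = 0 by apply: finj => //; move: fv; rewrite vE fD fd addr0.
    by move: gv; rewrite vE c0 add0r gd eqxx.
Qed.

Theorem theorem5p6
  (Psi : eqType) (F : fieldType) (k : divringClosed F)
  (* k is a proper subfield of F, algebraically closed in F *)
  (k_proper : exists x : F, x \notin k)
  (k_algclosed : forall (p : {poly F}) (x : F),
      p != 0 -> p \is a polyOver k -> root p x -> x \in k)
  (* L = F_Psi with its structure maps and S_Psi-action *)
  (L : fieldType) (kappa : F -> L) (iota : Psi -> {rmorphism F -> L})
  (HL : is_frac_restricted_tensor k kappa iota)
  (act : perm_of Psi -> {rmorphism L -> L})
  (Hact : is_perm_action k kappa iota act)
  (* K : an S_Psi-invariant subfield of F_Psi, embedded by phi *)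
  (K : fieldType) (phi : {rmorphism K -> L}) (actK : perm_of Psi -> K -> K)
  (HK : forall s a, phi (actK s a) = act s (phi a)) :
  (* F_Psi is an object of Sm_K(S_Psi) *)
  smooth (fun s => act s) /\
  (* F_Psi is injective in Sm_K(S_Psi) *)
  (forall (M N : lmodType K) (rhoM : perm_of Psi -> M -> M)
          (rhoN : perm_of Psi -> N -> N) (j : M -> N) (f : M -> L),
     smooth_semirep actK rhoM -> smooth_semirep actK rhoN ->
     rep_morph rhoM rhoN j -> injective j ->
     rep_morph_to phi (fun s => act s) rhoM f ->
     exists g : N -> L, rep_morph_to phi (fun s => act s) rhoN g /\
                        forall x, g (j x) = f x) /\
  (* (i) F_Psi is a cogenerator: every object embeds into a product of
     copies of F_Psi *)
  (forall (M : lmodType K) (rhoM : perm_of Psi -> M -> M),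
     smooth_semirep actK rhoM ->
     exists (I : Type) (f : I -> M -> L),
       (forall i, rep_morph_to phi (fun s => act s) rhoM (f i)) /\
       injective (fun x i => f i x)) /\
  (* (ii) finite length smooth F_Psi-semilinear representations are
     direct sums of copies of F_Psi *)
  (forall (M : lmodType L) (rho : perm_of Psi -> M -> M),
     smooth_semirep (fun s => act s) rho -> finite_length rho ->
     exists (n : nat) (f : M -> 'rV[L]_n),
       rep_morph rho (fun s => map_mx (act s)) f /\ bijective f).
Proof.
have [x xk] := k_proper; have gf := frac_tensor_gfield HL Hact xk.
split; first exact: (gf_smooth gf).
split=> [M N rhoM rhoN j f _ HN Hj jinj Hf|].
  exact: (morphism_extension gf HK HN Hj jinj Hf).
split=> [M rhoM HM|M rho HM].
  (* The product is indexed by all morphisms to [F_Psi]; they separate points by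
     [morphism_nonzero]. *)
  pose T := {f : M -> L | rep_morph_to phi (fun s => act s) rhoM f}.
  exists T, (fun i : T => sval i); split=> [[]//|y z yz].
  apply/eqP; rewrite -subr_eq0; apply/negPn/negP => yz0.
  have [g [gm /eqP gyz]] := morphism_nonzero gf HK HM yz0; apply: gyz.
  have := congr1 (fun h => h (exist _ g gm)) yz => /= gyz.
  have [gD gZ _] := gm.
  by rewrite gD -scaleN1r gZ rmorphN rmorph1 mulN1r gyz subrr.
apply: finite_length_trivial; first by case: HM.
by move=> y y0; apply: (morphism_nonzero (phi := idfun) gf _ HM).
Qed.
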